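(* Let $R=\mathbb C[x_1,\dots,x_n]$ and let $I=(f_1,\dots,f_r)\subseteq R$ be a nonzero equidimensional ideal of height $c$. Let $S=R[u_{ij}\mid 1\le i\le c,\ 1\le j\le r]$ be the polynomial ring over $R$ in $cr$ new variables, let $g_i=u_{i1}f_1+\cdots+u_{ir}f_r$ for $1\le i\le c$, let $L=(g_1,\dots,g_c)\subseteq S$, and let $J=(L:_S IS)$ be the generic linkage of $I$. Let $A\subseteq\mathbb C$ be a finitely generated $\mathbb Z$-subalgebra containing all coefficients of $f_1,\dots,f_r$ and of a chosen finite set of generators of $J$. Then, after possibly replacing $A$ by a localization $A_a$ with $0\ne a\in A$, there exist a prime $P$ and a constant $C_1$ such that for every prime $p>P$ and every maximal ideal $\mathfrak m_p$ of $A$ whose residue field has characteristic $p$, the reductions $I_p,L_p,J_p$ modulo $p$ with respect to $\mathfrak m_p$ satisfy $$\operatorname{fpt}_S(L_p)\le \operatorname{fpt}_R(I_p)\le \operatorname{fpt}_S(L_p)+\frac{C_1}{p}\le \operatorname{fpt}_S(J_p)+\frac{C_1}{p}.$$ In particular, $C_1$ is independent of $p$. Here $\operatorname{fpt}$ denotes the F-pure threshold, and $\operatorname{fpt}_R(I_p)$, $\operatorname{fpt}_S(L_p)$, $\operatorname{fpt}_S(J_p)$ are computed in the polynomial rings over $A/\mathfrak m_p$ in the variables of $R$ and $S$ respectively.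
   Context: An ideal is equidimensional if it is proper and all its minimal primes have the same height. The generic linkage $J$ is formed with respect to the chosen generators $f_1,\dots,f_r$ of $I$. Reduction modulo $p$. Let $T$ be a polynomial ring over $\mathbb C$ in finitely many variables $z$, let $\mathfrak a=(h_1,\dots,h_m)\subseteq T$, and let $A\subseteq\mathbb C$ be a finitely generated $\mathbb Z$-subalgebra containing the coefficients of the $h_i$. Let $\mathfrak a_A$ be the ideal of $A[z]$ generated by $h_1,\dots,h_m$. For a maximal ideal $\mathfrak m_p$ of $A$ with residue field $\Bbbk(p)=A/\mathfrak m_p$ of characteristic $p$, the reduction $\mathfrak a_p$ is the ideal generated by the image of $\mathfrak a_A$ in $A[z]\otimes_A\Bbbk(p)=\Bbbk(p)[z]$. Here $I$, $L$, $J$ are reduced using the generators $f_1,\dots,f_r$; $g_1,\dots,g_c$; and the chosen generators of $J$, respectively. F-pure threshold. Let $T$ be a reduced F-finite F-pure ring of characteristic $p>0$, and let $\mathfrak a\subseteq T$ be an ideal that contains an element outside every minimal prime of $T$. For $e\ge0$ let $F^e_*T$ denote $T$ viewed as a $T$-module via the $e$-th iterated Frobenius $r\mapsto r^{p^e}$, with the element corresponding to $b\in T$ written $F^e_*b$. For real $t\ge0$, the pair $(T,\mathfrak a^t)$ is F-pure if for all sufficiently large $q=p^e$ there is an element $b\in\mathfrak a^{\lfloor t(q-1)\rfloor}$ such that the inclusion into $F^e_*T$ of the $T$-submodule generated by $F^e_*b$ (i.e. the map $T\to F^e_*T$, $1\mapsto F^e_*b$) splits over $T$. The F-pure threshold is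 $\operatorname{fpt}_T(\mathfrak a)=\sup\{t\in\mathbb R_{>0}:(T,\mathfrak a^t)\text{ is F-pure}\}$. *)

(* Defs.v *)
From HB Require Import structures.
From mathcomp Require Import all_boot all_order all_algebra.
From mathcomp Require Import generic_quotient ring_quotient.
From mathcomp Require Import boolp classical_sets.
From mathcomp Require Import reals constructive_ereal ereal.
From mathcomp Require Import complex.
From mathcomp Require Import -(notations) mpoly.

Set Implicit Arguments.
Unset Strict Implicit.
Unset Printing Implicit Defensive.

Import Order.TTheory GRing.Theory Num.Theory.

Local Open Scope classical_set_scope.
Local Open Scope quotient_scope.
Local Open Scope ring_scope.

(* The notations of mpoly and constructive_ereal conflict (associativity at
   level 2), so the two mpoly notations that are needed are restated. *)
Notation "{ 'mpoly' T [ n ] }" := (mpoly n T)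
  (at level 0, T, n at level 2, format "{ 'mpoly'  T [ n ] }") : type_scope.
Notation "''X_' i" := (mpolyX _ (mnm1 i))
  (at level 8, i at level 2, format "''X_' i") : ring_scope.

Section Ideals.
Variable T : comNzRingType.
Implicit Types (I J P Q X : set T).

Definition is_ideal I :=
  [/\ I 0, (forall x y, I x -> I y -> I (x + y))
         & (forall a x, I x -> I (a * x))].

Definition ideal_gen X : set T := smallest is_ideal X.

Definition ideal_colon L I : set T := [set x | forall y, I y -> L (x * y)].

(* The empty product gives ideal_pow I 0 = T. *)
Definition ideal_pow I k : set T :=
  ideal_gen [set x | exists g : 'I_k -> T, (forall i, I (g i)) /\
                                           x = \prod_(i < k) g i].

Definition prime_ideal P :=
  [/\ is_ideal P, ~ P 1 & forall x y, P (x * y) -> P x \/ P y].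

Definition minimal_prime I P :=
  [/\ prime_ideal P, I `<=` P
    & forall Q, prime_ideal Q -> I `<=` Q -> Q `<=` P -> Q = P].

(* There is a chain of primes Q 0 < Q 1 < ... < Q k = P. *)
Definition prime_height_ge P k :=
  exists Q : nat -> set T,
    [/\ forall i, (i <= k)%N -> prime_ideal (Q i),
        forall i, (i < k)%N -> Q i `<` Q i.+1
      & Q k = P].

Definition prime_height P h := prime_height_ge P h /\ ~ prime_height_ge P h.+1.

(* The height of an ideal is the least height of a prime containing it. *)
Definition ideal_height I h :=
  (exists P, [/\ prime_ideal P, I `<=` P & prime_height P h]) /\
  (forall P, prime_ideal P -> I `<=` P -> prime_height_ge P h).

Definition equidimensional I :=
  ~ I 1 /\
  forall P Q, minimal_prime I P -> minimal_prime I Q ->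
    forall h, prime_height P h <-> prime_height Q h.

Definition maximal_ideal I :=
  [/\ is_ideal I, ~ I 1
    & forall J, is_ideal J -> I `<=` J -> ~ J 1 -> J = I].

End Ideals.

Section FPurity.
Variables (T : comNzRingType) (p : nat) (chT : p \in [pchar T]).

(* F^e_* T: the additive group of T with r acting as multiplication by
   r ^+ (p ^ e). *)
Definition frob_push of (p \in [pchar T]) & nat := (T : Type).

Variable e : nat.
Local Notation FT := (frob_push chT e).

HB.instance Definition _ := GRing.Zmodule.copy FT T.

Definition frob_scale (r : T) (x : FT) : FT := r ^+ (p ^ e) * (x : T).

Lemma frob_scaleA a b v :
  frob_scale a (frob_scale b v) = frob_scale (a * b) v.
Proof. by rewrite /frob_scale exprMn mulrA. Qed.

Lemma frob_scale1 : left_id 1 frob_scale.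
Proof. by move=> v; rewrite /frob_scale expr1n mul1r. Qed.

Lemma frob_scaleDr : right_distributive frob_scale +%R.
Proof. by move=> a u v; rewrite /frob_scale mulrDr. Qed.

Lemma frob_scaleDl v : {morph frob_scale^~ v : a b / a + b}.
Proof.
move=> a b; rewrite /frob_scale exprDn_pchar ?mulrDl // pnatX.
by rewrite pnatE ?chT // (pcharf_prime chT).
Qed.

HB.instance Definition _ := GRing.Zmodule_isLmodule.Build T FT
  frob_scaleA frob_scale1 frob_scaleDr frob_scaleDl.

End FPurity.

Section FPT.
Variables (RR : realType) (T : comNzRingType) (p : nat) (chT : p \in [pchar T]).

(* The T-linear map T -> F^e_* T sending 1 to F^e_* b has a T-linear
   retraction. *)
Definition frob_splits (e : nat) (b : T) :=
  exists phi : {linear frob_push chT e -> T^o},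
    forall r : T, phi (r *: (b : frob_push chT e)) = r.

Definition F_pure_pair (a : set T) (t : RR) :=
  exists e0 : nat, forall e, (e0 <= e)%N ->
    exists2 b : T, ideal_pow a (Num.truncn (t * (p ^ e - 1)%N%:R)) b
                 & frob_splits e b.

(* The supremum is taken in the extended reals, where the supremum of an
   unbounded set is +oo. *)
Definition fpt (a : set T) : \bar RR :=
  ereal_sup [set t%:E | t in [set t : RR | 0 < t /\ F_pure_pair a t]].

End FPT.

Section Subring.
Variables (U : comNzRingType) (A : subringClosed U).

Definition subring_of := {x : U | x \in A}.

HB.instance Definition _ := [isSub of subring_of for @sval U (fun x => x \in A)].
HB.instance Definition _ := [Choice of subring_of by <:].
HB.instance Definition _ := [SubChoice_isSubComNzRing of subring_of by <:].

(* The localization of A at a, as a subset of the ambient ring U: when U is a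
   domain and a is nonzero this is A[1/a]. *)
Definition localization (a : subring_of) : {pred U} :=
  fun x => `[< exists k : nat, val a ^+ k * x \in A >].

Lemma localization_closed a : subring_closed (localization a).
Proof.
have aP k : val a ^+ k \in A by rewrite rpredX // (valP a).
split.
- by apply/asboolP; exists 0%N; rewrite expr0 mulr1 rpred1.
- move=> x y /asboolP[k kx] /asboolP[l ly]; apply/asboolP; exists (k + l)%N.
  have -> : val a ^+ (k + l) * (x - y) =
            val a ^+ l * (val a ^+ k * x) - val a ^+ k * (val a ^+ l * y).
    by rewrite mulrBr {1}addnC !exprD !mulrA.
  by apply: rpredB; apply: rpredM.
- move=> x y /asboolP[k kx] /asboolP[l ly]; apply/asboolP; exists (k + l)%N.
  by rewrite exprD mulrACA rpredM.
Qed.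

HB.instance Definition _ a :=
  GRing.isSubringClosed.Build U (localization a) (localization_closed a).

(* A is generated by finitely many elements as a Z-algebra. *)
Definition finitely_generated_Zalg :=
  exists (k : nat) (s : k.-tuple U), forall x : U,
    x \in A <-> exists q : {mpoly int[k]},
                  x = meval (tnth s) (map_mpoly intr q).

End Subring.

Section Reduction.
Variables (U : comNzRingType) (A : subringClosed U) (N k : nat).

(* The ideal of A[z] generated by h_1, ..., h_k, where the coefficients of the
   h_i lie in A. *)
Definition ideal_over (h : 'I_k -> {mpoly U[N]}) : set {mpoly (subring_of A)[N]} :=
  ideal_gen [set q | exists i, map_mpoly (val : subring_of A -> U) q = h i].

Variable m : idealr (subring_of A).

Definition ideal_red (h : 'I_k -> {mpoly U[N]}) : set {mpoly {ideal_quot m}[N]} :=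
  ideal_gen (map_mpoly \pi_({ideal_quot m}) @` ideal_over h).

End Reduction.

Arguments ideal_red {U A N k} m h.

Lemma pchar_mpoly (K : comNzRingType) (N p : nat) :
  p \in [pchar K] -> p \in [pchar {mpoly K[N]}].
Proof. exact: (rmorph_pchar (@mpolyC N K)). Qed.

Section GenericLinkage.
Variables (C : comNzRingType) (n c r : nat).

(* S = R[u_ij] is C[z] with n + c * r variables: the first n are x_1, ..., x_n,
   the other ones are the u_ij. *)
Definition to_generic (q : {mpoly C[n]}) : {mpoly C[n + c * r]} :=
  comp_mpoly [tuple 'X_(lshift (c * r) i) | i < n] q.

Definition generic_u (i : 'I_c) (j : 'I_r) : {mpoly C[n + c * r]} :=
  'X_(rshift n (mxvec_index i j)).

Definition generic_g (f : 'I_r -> {mpoly C[n]}) (i : 'I_c) :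
    {mpoly C[n + c * r]} :=
  \sum_(j < r) generic_u i j * to_generic (f j).

(* The extension IS is generated by the images of the f_j. *)
Definition generic_linkage (f : 'I_r -> {mpoly C[n]}) :
    set {mpoly C[n + c * r]} :=
  ideal_colon (ideal_gen (range (generic_g f)))
              (ideal_gen (to_generic @` ideal_gen (range f))).

End GenericLinkage.

Arguments generic_g {C n} c {r} f i.
Arguments generic_linkage {C n} c {r} f.

(* Main.v *)
From HB Require Import structures.
Require Import Defs.
From mathcomp Require Import all_boot all_order all_algebra.
From mathcomp Require Import fieldext generic_quotient ring_quotient.
From mathcomp Require Import boolp classical_sets.
From mathcomp Require Import reals constructive_ereal ereal.
From mathcomp Require Import complex.
From mathcomp Require Import -(notations) mpoly.

Set Implicit Arguments.
Unset Strict Implicit.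
Unset Printing Implicit Defensive.

Import Order.TTheory GRing.Theory Num.Theory.

Local Open Scope classical_set_scope.
Local Open Scope quotient_scope.
Local Open Scope ring_scope.

(** Write D(q, N, I) for the statement that 1 is in the ideal generated by all
    phi(b), with b in I^N and phi : T -> T additive such that
    phi(r^q x) = r phi(x).  F-purity of (T, I^t) gives D(p^e, N, I) for
    N = floor(t (p^e - 1)) and all large e.  Conversely, in a polynomial ring in
    at least one variable D(p^e, N, I) implies fpt(I) >= N / p^e
    ([trace_ideal_split_elt]): a relation 1 = sum_j phi_j(b_j) is made into a
    single split element sum_j b_j^(p^d) x^j at a higher level.  So only
    D(q, N, I) has to be compared for the various ideals.

    The inequality fpt(L_p) <= fpt(I_p) holds because L is contained in the
    extension of I and because a map on S gives a map on R by restriction to R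
    and specialization u = 0 ([trace_linkage_sub]).

    For fpt(I_p) <= fpt(L_p) + C / p, rounding exponents down to multiples of
    p^(e-1) reduces D(p^e, N, I) to D(p, M, I) with M / p >= N / p^e - C / p
    ([trace_ideal_level]).  If M <= c (p - 1), a product f_(j_1) ... f_(j_M) is,
    up to a multinomial coefficient prime to p, the coefficient of the monomial
    u_(i_1 j_1) ... u_(i_M j_M) in g_(i_1) ... g_(i_M), where the i_k are
    chosen so that every row is used at most p - 1 times.  All exponents of u
    are then below p, so taking that coefficient is linear over p-th
    powers and D(p, M, L) follows ([trace_linkage_sup]).

    It remains to see that D(p, M, I_p) forces M <= c (p - 1), uniformly in p
    ([reduction_trace_bound]).  Let P be a prime of height c containing I, and
    P_A its trace on A[x].  By induction on the variables there are k <= c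
    elements g of P_A and h outside P_A such that h I is contained in (g)
    ([height_locally_generated]).  If M > k (p - 1), every h^M b with b in I^M
    is in the ideal of the p-th powers of the g, so D(p, M, I_p) would imply
    that h^M is in (g) modulo p.  Chevalley's extension argument
    ([extend_specialization_mpoly]) excludes this after inverting one nonzero
    a in A: every morphism from A to a field that does not kill a extends to a
    morphism on A[x] that kills P_A but not h.

    Finally L_p is contained in J_p once a denominator is inverted: the g_i
    are combinations of the generators of J over C, and applying a linear
    retraction of C onto Frac(A) to the coefficients shows that they are such
    combinations over Frac(A) ([ideal_gen_descent]). *)

Local Notation "p @_ i" := (mcoeff i p)
  (at level 3, i at level 2, left associativity, format "p @_ i") : ring_scope.
Local Notation "''X_[' i ]" := (mpolyX _ i)
  (at level 8, i at level 2, format "''X_[' i ]") : ring_scope.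

(** * Ideals and their powers *)

Section IdealTheory.
Variable T : comNzRingType.
Implicit Types (I J X Y Z : set T).

Lemma ideal_gen_ideal X : is_ideal (ideal_gen X).
Proof.
split.
- by move=> I [[]].
- move=> x y Xx Xy I IX; have [[_ ID _] _] := IX.
  by apply: ID; [exact: (Xx _ IX) | exact: (Xy _ IX)].
- move=> a x Xx I IX; have [[_ _ IM] _] := IX.
  by apply: IM; exact: (Xx _ IX).
Qed.

Lemma sub_ideal_gen X : X `<=` ideal_gen X.
Proof. by move=> x Xx I [_]; apply. Qed.

Lemma ideal_gen_min I X : is_ideal I -> X `<=` I -> ideal_gen X `<=` I.
Proof. by move=> Iid XI x; apply; split. Qed.

Lemma ideal_gen_mono X Y : X `<=` Y -> ideal_gen X `<=` ideal_gen Y.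
Proof.
move=> XY; apply: ideal_gen_min; first exact: ideal_gen_ideal.
by move=> x /XY; apply: sub_ideal_gen.
Qed.

Lemma ideal_opp I x : is_ideal I -> I x -> I (- x).
Proof. by case=> _ _ IM Ix; rewrite -mulN1r; apply: IM. Qed.

Lemma ideal_sub I x y : is_ideal I -> I x -> I y -> I (x - y).
Proof. by move=> Iid Ix Iy; have [_ ID _] := Iid; apply: ID => //; apply: ideal_opp. Qed.

Lemma ideal_mulr I x a : is_ideal I -> I x -> I (x * a).
Proof. by case=> _ _ IM Ix; rewrite mulrC; apply: IM. Qed.

Lemma ideal_sum I (A : Type) (r : seq A) (F : A -> T) :
  is_ideal I -> (forall i, I (F i)) -> I (\sum_(i <- r) F i).
Proof. by case=> I0 ID _ IF; elim/big_ind: _. Qed.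

Lemma ideal_pow_prod X k (g : 'I_k -> T) :
  (forall i, X (g i)) -> ideal_pow X k (\prod_(i < k) g i).
Proof. by move=> Xg; apply: sub_ideal_gen; exists g. Qed.

Lemma ideal_pow_ideal X k : is_ideal (ideal_pow X k).
Proof. exact: ideal_gen_ideal. Qed.

Lemma ideal_pow_min X k I : is_ideal I ->
  (forall g : 'I_k -> T, (forall i, X (g i)) -> I (\prod_(i < k) g i)) ->
  ideal_pow X k `<=` I.
Proof. by move=> Iid IX; apply: ideal_gen_min => // _ [g [Xg ->]]; exact: IX. Qed.

Lemma ideal_pow_mono X Y k : X `<=` Y -> ideal_pow X k `<=` ideal_pow Y k.
Proof.
move=> XY; apply: ideal_pow_min; first exact: ideal_pow_ideal.
by move=> g Xg; apply: ideal_pow_prod => i; apply: XY.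
Qed.

Lemma ideal_pow_mul X j k x y :
  ideal_pow X j x -> ideal_pow X k y -> ideal_pow X (j + k) (x * y).
Proof.
have [H0 HD HM] := ideal_pow_ideal X (j + k).
move=> jx; move: y; apply: (@ideal_gen_min [set y | ideal_pow X (j + k) (x * y)]).
  split=> /= [|y z|a y]; first by rewrite mulr0.
  - by rewrite mulrDr; apply: HD.
  - by rewrite mulrCA; apply: HM.
move=> _ [h [Xh ->]] /=; move: x jx.
apply: (@ideal_gen_min [set x | ideal_pow X (j + k) (x * _)]).
  split=> /= [|y z|a y]; first by rewrite mul0r.
  - by rewrite mulrDl; apply: HD.
  - by rewrite -mulrA; apply: HM.
move=> _ [g [Xg ->]] /=.
pose gh (i : 'I_(j + k)) := match split i with inl a => g a | inr b => h b end.
have -> : \prod_(i < j) g i * \prod_(i < k) h i = \prod_(i < j + k) gh i.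
  rewrite big_split_ord /=; congr (_ * _); apply: eq_bigr => i _; rewrite /gh.
    by rewrite (unsplitK (inl i)).
  by rewrite (unsplitK (inr i)).
by apply: ideal_pow_prod => i; rewrite /gh; case: split.
Qed.

Lemma ideal_pow1 X : ideal_gen X `<=` ideal_pow X 1.
Proof.
apply: ideal_gen_min; first exact: ideal_pow_ideal.
move=> x Xx; have -> : x = \prod_(i < 1) x by rewrite big_ord1.
exact: ideal_pow_prod.
Qed.

Lemma ideal_pow0 X : ideal_pow X 0 1.
Proof.
have -> : 1 = \prod_(i < 0) (1 : T) by rewrite big_ord0.
by apply: ideal_pow_prod => -[].
Qed.

Lemma ideal_pow_exp X k x m : ideal_pow X k x -> ideal_pow X (k * m) (x ^+ m).
Proof.
move=> Xx; elim: m => [|m IH]; first by rewrite muln0; apply: ideal_pow0.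
by rewrite mulnS exprS; apply: ideal_pow_mul.
Qed.

(** Expanding the products shows that the powers of an ideal can be computed
    from any set of generators. *)
Lemma ideal_pow_gen X k : ideal_pow (ideal_gen X) k `<=` ideal_pow X k.
Proof.
apply: ideal_pow_min; first exact: ideal_pow_ideal.
elim: k => [|k IH] g Xg; first by rewrite big_ord0; apply: ideal_pow0.
rewrite big_ord_recr -[X in ideal_pow _ X]addn1.
by apply: ideal_pow_mul; [apply: IH | apply: ideal_pow1].
Qed.

Lemma ideal_pow_le X j k : (j <= k)%N -> ideal_pow X k `<=` ideal_pow X j.
Proof.
move=> /subnKC <-; apply: ideal_pow_min; first exact: ideal_pow_ideal.
move=> g Xg; rewrite big_split_ord /=.
apply: (ideal_mulr _ (ideal_pow_ideal _ _)).
by apply: ideal_pow_prod => i.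
Qed.

Lemma ideal_preim (U : comNzRingType) (s : {rmorphism U -> T}) I :
  is_ideal I -> is_ideal [set x | I (s x)].
Proof.
case=> I0 ID IM; split=> [|x y|a x] /=; first by rewrite rmorph0.
  by rewrite rmorphD; apply: ID.
by rewrite rmorphM; apply: IM.
Qed.

Lemma prime_ideal_preim (U : comNzRingType) (s : {rmorphism U -> T}) I :
  prime_ideal I -> prime_ideal [set x | I (s x)].
Proof.
case=> Iid I1 Ip; split=> /=; first exact: ideal_preim.
  by rewrite rmorph1.
by move=> x y; rewrite rmorphM; apply: Ip.
Qed.

Lemma prime_ideal_exp I x k : prime_ideal I -> I (x ^+ k) -> I x.
Proof.
case=> _ I1 Ip; elim: k => [|k IH]; first by rewrite expr0 => /I1.
by rewrite exprS => /Ip [].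
Qed.

Lemma prime_ideal_prod I (A : Type) (r : seq A) (F : A -> T) :
  prime_ideal I -> (forall i, ~ I (F i)) -> ~ I (\prod_(i <- r) F i).
Proof.
move=> [_ I1 Ip] IF; elim/big_ind: _ => // x y Ix Iy.
by case/Ip.
Qed.

(** Pigeonhole: a product of more than a * (q - 1) of the a generators repeats
    one of them q times. *)
Lemma ideal_pow_frobenius a q k (g : 'I_a -> T) : (a * q.-1 < k)%N ->
  ideal_pow (range g) k `<=` ideal_gen (range (fun i => g i ^+ q)).
Proof.
move=> ltk; apply: ideal_pow_min; first exact: ideal_gen_ideal.
move=> h hg; have /choice[s hs] : forall i, exists j, g j = h i.
  by move=> i; case: (hg i) => j _ <-; exists j.
have -> : \prod_(i < k) h i = \prod_(j < a) g j ^+ #|[set i | s i == j]%SET|.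
  rewrite (eq_bigr (fun i => g (s i))) => [|i _]; last by rewrite hs.
  rewrite (partition_big s predT) //=; apply: eq_bigr => j _.
  rewrite (eq_bigr (fun=> g j)) => [|i /eqP -> //].
  by rewrite prodr_const; congr (_ ^+ _); apply: eq_card => i; rewrite inE.
have [j lej] : exists j, (q <= #|[set i | s i == j]%SET|)%N.
  apply: contrapT => /forallNP lt; move: ltk; rewrite ltnNge => /negP; apply.
  rewrite -{1}(card_ord k) -sum1_card (partition_big s predT) //=.
  have -> : (a * q.-1 = \sum_(j < a) q.-1)%N by rewrite sum_nat_const card_ord.
  apply: leq_sum => j _.
  rewrite sum1_card; case: q lt => [|q] lt; first by case: (lt j).
  move/negP: (lt j); rewrite -ltnNge ltnS.
  by congr (_ <= _)%N; apply: eq_card => i; rewrite inE.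
rewrite (bigD1 j) //= -(subnKC lej) exprD -mulrA.
apply: (ideal_mulr _ (ideal_gen_ideal _)).
by apply: sub_ideal_gen; exists j.
Qed.

End IdealTheory.

(** * Maps that are linear over the Frobenius *)

Section Cartier.
Variables (T : comNzRingType) (q : nat).
Implicit Types (X Z B : set T) (phi : T -> T).

(** For q = p ^ e these are the T-linear maps F^e_* T -> T. *)
Definition cartier_map phi :=
  (forall x y, phi (x + y) = phi x + phi y) /\
  (forall r x, phi (r ^+ q * x) = r * phi x).

(** For q = p ^ e in a regular F-finite ring this is the smallest ideal J with
    B contained in the ideal generated by the q-th powers of J. *)
Definition trace_ideal B : set T :=
  ideal_gen [set x | exists phi b, [/\ cartier_map phi, B b & x = phi b]].

Lemma cartier_map_mull phi a :
  cartier_map phi -> cartier_map (fun x => phi (a * x)).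
Proof.
case=> phiD phiM; split=> [x y|r x]; first by rewrite mulrDr phiD.
by rewrite mulrCA phiM.
Qed.

Lemma cartier_map0 phi : cartier_map phi -> phi 0 = 0.
Proof. by case=> phiD _; apply: (addrI (phi 0)); rewrite -phiD !addr0. Qed.

Lemma cartier_map_sum phi (A : Type) (r : seq A) (F : A -> T) :
  cartier_map phi -> phi (\sum_(i <- r) F i) = \sum_(i <- r) phi (F i).
Proof.
move=> phiC; apply: (big_morph phi); first by case: phiC.
exact: cartier_map0.
Qed.

Lemma cartier_map_bigsum (A : Type) (r : seq A) (F : A -> T -> T) :
  (forall i, cartier_map (F i)) ->
  cartier_map (fun x => \sum_(i <- r) F i x).
Proof.
move=> FC; split=> [x y|a x].
  by rewrite -big_split; apply: eq_bigr => i _; case: (FC i).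
by rewrite mulr_sumr; apply: eq_bigr => i _; case: (FC i).
Qed.

Lemma trace_ideal_ideal B : is_ideal (trace_ideal B).
Proof. exact: ideal_gen_ideal. Qed.

Lemma trace_ideal_cartier B phi b :
  cartier_map phi -> B b -> trace_ideal B (phi b).
Proof. by move=> phiC Bb; apply: sub_ideal_gen; exists phi, b. Qed.

Lemma trace_ideal_min B Z : is_ideal Z ->
  (forall phi b, cartier_map phi -> B b -> Z (phi b)) -> trace_ideal B `<=` Z.
Proof.
move=> Zid ZB; apply: ideal_gen_min => // _ [phi [b [phiC Bb ->]]].
exact: ZB.
Qed.

Lemma cartier_preim_ideal Z : is_ideal Z ->
  is_ideal [set b | forall phi, cartier_map phi -> Z (phi b)].
Proof.
case=> Z0 ZD ZM; split=> /= [phi phiC|x y Zx Zy phi phiC|a x Zx phi phiC].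
- by rewrite (cartier_map0 phiC).
- by case: (phiC) => -> _; apply: ZD; [apply: Zx | apply: Zy].
- exact: (Zx _ (cartier_map_mull a phiC)).
Qed.

(** The elements sent into Z by all the maps form an ideal, so only products of
    generators have to be tested. *)
Lemma trace_pow_min X k Z : is_ideal Z ->
  (forall phi (g : 'I_k -> T), cartier_map phi -> (forall i, X (g i)) ->
     Z (phi (\prod_(i < k) g i))) ->
  trace_ideal (ideal_pow X k) `<=` Z.
Proof.
move=> Zid ZX; apply: trace_ideal_min => // phi b phiC Xb; move: b Xb phi phiC.
apply: (@ideal_pow_min _ X k [set b | forall phi, cartier_map phi -> Z (phi b)]).
  exact: cartier_preim_ideal.
by move=> g Xg phi phiC; apply: ZX.
Qed.

(** Scalars disappear because a phi(b) = phi(a^q b). *)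
Lemma trace_idealP B x : (forall a b, B b -> B (a * b)) -> trace_ideal B x ->
  exists (k : nat) (phi : 'I_k -> T -> T) (b : 'I_k -> T),
    [/\ forall i, cartier_map (phi i), forall i, B (b i)
      & x = \sum_(i < k) phi i (b i)].
Proof.
move=> BM; move: x; apply: ideal_gen_min; last first.
  move=> _ [phi [b [phiC Bb ->]]] /=.
  by exists 1%N, (fun=> phi), (fun=> b); rewrite big_ord1.
split=> /=.
- by exists 0%N, (fun=> id), (fun=> 0); by split=> [[]|[]|] //; rewrite big_ord0.
- move=> _ _ [k [phi [b [phiC Bb ->]]]] [l [psi [c [psiC Bc ->]]]].
  exists (k + l)%N,
    (fun i => match split i with inl i => phi i | inr i => psi i end),
    (fun i => match split i with inl i => b i | inr i => c i end).
  split=> [i|i|]; try by case: split.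
  rewrite big_split_ord /=; congr (_ + _); apply: eq_bigr => i _.
    by rewrite (unsplitK (inl i)).
  by rewrite (unsplitK (inr i)).
- move=> a _ [k [phi [b [phiC Bb ->]]]].
  exists k, phi, (fun i => a ^+ q * b i); split=> // [i|]; first exact: BM.
  by rewrite mulr_sumr; apply: eq_bigr => i _; case: (phiC i).
Qed.

End Cartier.

(** * Retractions onto a subfield *)

(** A subset W that is maximal among the F-subspaces missing 1 is a complement
    of F: for x outside W the space W + F x contains 1, so x lies in W + F.
    The retraction is the projection along W. *)
Lemma subfield_retraction (C : comNzRingType) (F : set C) :
    F 1 -> (forall x y, F x -> F y -> F (x - y)) ->
    (forall x y, F x -> F y -> F (x * y)) ->
    (forall x, F x -> x != 0 -> exists2 y, F y & x * y = 1) ->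
  exists rho : C -> C,
    [/\ forall x, F (rho x), forall x y, rho (x + y) = rho x + rho y,
        forall a x, F a -> rho (a * x) = a * rho x & rho 1 = 1].
Proof.
move=> F1 FB FM FV.
have F0 : F 0 by rewrite -(subrr 1); apply: FB.
have FN x : F x -> F (- x) by rewrite -sub0r; apply: FB.
have FD x y : F x -> F y -> F (x + y).
  by move=> Fx Fy; rewrite -[y]opprK; apply/FB/FN.
pose P W := [/\ forall x y : C, W x -> W y -> W (x + y),
                forall a x, F a -> W x -> W (a * x) & ~ W 1].
have [G GP Gtot|W [[WD WM W1] Wmax]] := @Zorn_bigcup C P.
  split=> [x y [V GV Vx] [V' GV' Vy]|a x Fa [V GV Vx]|[V /GP[_ _ +]]//].
    have [VV'|V'V] := Gtot _ _ GV GV'.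
      by exists V' => //; have [VD _ _] := GP _ GV'; apply: VD => //; apply: VV'.
    by exists V => //; have [VD _ _] := GP _ GV; apply: VD => //; apply: V'V.
  by exists V => //; have [_ VM _] := GP _ GV; apply: VM.
have Wext x : W x \/ exists w a, [/\ w = 0 \/ W w, F a & 1 = w + a * x].
  apply: contrapT => /not_orP[nWx nW1].
  pose V := [set y | exists w a, [/\ w = 0 \/ W w, F a & y = w + a * x]].
  apply: (Wmax V).
    split=> [w Ww|VW].
      by exists w, 0; split; [right | | rewrite mul0r addr0].
    by apply/nWx/VW; exists 0, 1; split; [left | | rewrite add0r mul1r].
  split=> [_ _ [w [a [Ww Fa ->]]] [v [b [Wv Fb ->]]]|b _ Fb [w [a [Ww Fa ->]]]|//].
    exists (w + v), (a + b); split; [|exact: FD|by rewrite addrACA mulrDl].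
    case: Ww Wv => [->|Ww] [->|Wv]; rewrite ?addr0 ?add0r; auto.
  exists (b * w), (b * a); split; [|exact: FM|by rewrite mulrDr mulrA].
  by case: Ww => [->|Ww]; rewrite ?mulr0; [left | right; apply: WM].
have W0 : W 0.
  have [//|[w [a [Ww _]]]] := Wext 0.
  rewrite mulr0 addr0 => w1; case: Ww; rewrite -w1 // => /eqP.
  by rewrite oner_eq0.
have WN x : W x -> W (- x) by rewrite -mulN1r; apply/WM/FN.
have dec x : exists f, F f /\ W (x - f).
  have [Wx|[w [a [Ww Fa e1]]]] := Wext x; first by exists 0; rewrite subr0.
  have {}Ww : W w by case: Ww => [->|].
  have a0 : a != 0 by apply/eqP => a0; apply: W1; rewrite e1 a0 mul0r addr0.
  have [b Fb ab] := FV _ Fa a0.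
  exists b; split=> //.
  have -> : x - b = - b * w.
    by rewrite -[b in x - b]mulr1 e1 mulrDr mulrA [b * a]mulrC ab mul1r
      opprD addrCA subrr addr0 mulNr.
  by apply: WM => //; apply: FN.
have uniq_dec f g : F f -> F g -> W (f - g) -> f = g.
  move=> Ff Fg Wfg; apply/eqP; rewrite -subr_eq0; apply/negP => /negP fg0.
  have [h Fh eh] := FV _ (FB _ _ Ff Fg) fg0.
  by apply: W1; rewrite -eh mulrC; apply: WM.
have /choice[rho rhoP] := dec.
have Frho x : F (rho x) by case: (rhoP x).
have Wrho x : W (x - rho x) by case: (rhoP x).
have rhoE x f : F f -> W (x - f) -> rho x = f.
  move=> Ff Wxf; apply: uniq_dec => //.
  have -> : rho x - f = (x - f) - (x - rho x).
    by rewrite opprB [RHS]addrC addrA subrK.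
  by apply: WD => //; apply: WN.
exists rho; split=> // [x y|a x Fa|].
- apply: rhoE; first exact: FD.
  by rewrite opprD addrACA; apply: WD.
- by apply: rhoE; [exact: FM | rewrite -mulrBr; apply: WM].
- by apply: rhoE; rewrite ?subrr.
Qed.

Section FrobeniusRetraction.
Variables (K : comNzRingType) (p : nat).
Hypothesis chK : p \in [pchar K].
Hypothesis Kfield : forall x : K, x != 0 -> exists y, x * y = 1.

Lemma exprD_pchar e (x y : K) : (x + y) ^+ (p ^ e) = x ^+ (p ^ e) + y ^+ (p ^ e).
Proof.
by apply: exprDn_pchar; rewrite pnatX pnatE ?chK // (pcharf_prime chK).
Qed.

Lemma exprB_pchar e (x y : K) : (x - y) ^+ (p ^ e) = x ^+ (p ^ e) - y ^+ (p ^ e).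
Proof. by apply/eqP; rewrite eq_sym subr_eq -exprD_pchar subrK. Qed.

(** K need not be perfect, so the p ^ e-th root is preceded by a linear
    retraction of K onto its subfield of p ^ e-th powers. *)
Lemma frobenius_retraction e :
  exists2 pi : K -> K, cartier_map (p ^ e) pi & pi 1 = 1.
Proof.
have frob0 (x : K) : x ^+ (p ^ e) = 0 -> x = 0.
  move=> xq0; apply/eqP/negP => /negP /Kfield[y xy].
  by move: (oner_neq0 K); rewrite -(expr1n K (p ^ e)) -xy exprMn xq0 mul0r eqxx.
have frob_inj (x y : K) : x ^+ (p ^ e) = y ^+ (p ^ e) -> x = y.
  move=> xy; apply/eqP; rewrite -subr_eq0; apply/eqP/frob0.
  by rewrite exprB_pchar xy subrr.
pose F := range (fun x : K => x ^+ (p ^ e)).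
have [||||rho [Frho rhoD rhoM rho1]] := @subfield_retraction K F.
- by exists 1; rewrite ?expr1n.
- by move=> _ _ [x _ <-] [y _ <-]; exists (x - y); rewrite ?exprB_pchar.
- by move=> _ _ [x _ <-] [y _ <-]; exists (x * y); rewrite ?exprMn.
- move=> _ [x _ <-] x0.
  have /Kfield[y xy] : x != 0.
    apply: contraNneq x0 => ->; rewrite expr0n gtn_eqF //.
    by rewrite expn_gt0 prime_gt0 // (pcharf_prime chK).
  by exists (y ^+ (p ^ e)); [exists y | rewrite -exprMn xy expr1n].
have /choice[pi piE] : forall x, exists y, y ^+ (p ^ e) = rho x.
  by move=> x; have [y _ <-] := Frho x; exists y.
exists pi; last by apply: frob_inj; rewrite piE rho1 expr1n.
split=> [x y|r x]; apply: frob_inj.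
  by rewrite exprD_pchar !piE rhoD.
by rewrite exprMn !piE rhoM //; exists r.
Qed.

End FrobeniusRetraction.

(** * Selecting coefficients as a map linear over the Frobenius *)

Section CoefficientMap.
Variables (R : comNzRingType) (k q : nat).
Implicit Types (z : {mpoly R[k]}) (m D : multinom k) (psi : R -> R).

Definition exp_shift D m : multinom k := mnm_add (mnm_muln m q) D.

(** For psi the inverse of the q-th power map of a perfect field R, and D
    running over the exponents below q, these are the coordinate maps of F_* R[X]
    in the basis of monomials X^D. *)
Definition mextract psi D z : {mpoly R[k]} :=
  \sum_(m : bmultinom k (msize z)) psi z@_(exp_shift D m) *: 'X_[m].

Hypothesis q_gt0 : (0 < q)%N.

Lemma mcoeff_mextract psi D z m : psi 0 = 0 ->
  (mextract psi D z)@_m = psi z@_(exp_shift D m).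
Proof.
move=> psi0; rewrite raddf_sum /=.
have [lt_m|ge_m] := ltnP (mdeg m) (msize z).
  rewrite (bigD1 (BMultinom lt_m)) //= mcoeffZ mcoeffX eqxx mulr1 big1 ?addr0 //.
  move=> m' ne_m; rewrite mcoeffZ mcoeffX.
  case: eqP => [e|_]; last by rewrite mulr0.
  by case/eqP: ne_m; apply: val_inj.
rewrite big1 => [|m' _]; last first.
  rewrite mcoeffZ mcoeffX; case: eqP => [e|_]; last by rewrite mulr0.
  by move: ge_m; rewrite leqNgt -e bmdeg.
rewrite memN_msupp_eq0 ?psi0 //; apply: msize_mdeg_ge.
apply: leq_trans ge_m _; rewrite mdegD mdegMn.
by apply: leq_trans (leq_addr _ _); apply: leq_pmulr.
Qed.

Lemma mcoeffMX_ngt z m m' : ~~ lem m m' -> (z * 'X_[m])@_m' = 0.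
Proof.
move=> nle; rewrite [z]mpolyE mulr_suml raddf_sum /= big1 // => i _.
rewrite -scalerAl -mpolyXD mcoeffZ mcoeffX; case: eqP => [e|_]; last first.
  by rewrite mulr0.
by case/negP: nle; rewrite -e; apply: lem_addl.
Qed.

End CoefficientMap.

Lemma mextract_cartier (R : comNzRingType) (p k e : nat) (psi : R -> R)
    (D : multinom k) : p \in [pchar R] -> (forall i, D i < p ^ e)%N ->
  cartier_map (p ^ e) psi ->
  cartier_map (p ^ e) (@mextract R k (p ^ e) psi D).
Proof.
move=> chR Dlt psiC; have psi0 := cartier_map0 psiC.
have q0 : (0 < p ^ e)%N by rewrite expn_gt0 prime_gt0 ?(pcharf_prime chR).
have extD x y : mextract (p ^ e) psi D (x + y) =
    mextract (p ^ e) psi D x + mextract (p ^ e) psi D y.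
  apply/mpolyP => m; rewrite mcoeffD !mcoeff_mextract // mcoeffD.
  by case: psiC.
split=> // r z; elim/mpolyind: r => [|c m r _ _ IH].
  rewrite expr0n gtn_eqF //= !mul0r.
  by apply/mpolyP => m; rewrite mcoeff_mextract // !mcoeff0.
rewrite (exprD_pchar (pchar_mpoly k chR)) !mulrDl extD IH; congr (_ + _).
apply/mpolyP => m'; rewrite mcoeff_mextract // exprZn mpolyXn -!scalerAl !mcoeffZ.
have [_ ->] := psiC; congr (_ * _); rewrite ![mpolyX _ _ * _]mulrC.
have [le_m|nle_m] := boolP (lem m m').
  have -> : exp_shift (p ^ e) D m' = mnm_add (mnm_muln m (p ^ e))
      (exp_shift (p ^ e) D (mnm_sub m' m)).
    apply/mnmP => i; rewrite !mnmDE !mulmnE mnmBE addnA -mulnDl subnKC //.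
    by have /mnm_lepP := le_m.
  rewrite mcoeffMX; have -> : m' = mnm_add m (mnm_sub m' m).
    by rewrite addmC submK.
  rewrite mcoeffMX mcoeff_mextract //.
  by congr (psi (mcoeff (exp_shift _ _ _) _)); apply/mnmP => i;
     rewrite !mnmE addnC addnK.
rewrite !mcoeffMX_ngt //; apply: contra nle_m => /mnm_lepP le_q.
apply/mnm_lepP => i; have := le_q i; rewrite !mnmDE !mulmnE => le_i.
rewrite -ltnS -(ltn_pmul2r q0); apply: leq_ltn_trans le_i _.
by rewrite mulSn addnC ltn_add2r.
Qed.

(** * From trace ideals to split elements *)

Lemma cartier_map_comp (T : comNzRingType) q1 q2 (phi chi : T -> T) :
  cartier_map q1 phi -> cartier_map q2 chi -> cartier_map (q1 * q2) (phi \o chi).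
Proof.
move=> [phiD phiM] [chiD chiM]; split=> [x y|r x] /=; first by rewrite chiD phiD.
by rewrite exprM chiM phiM.
Qed.

Section ManyToOne.
Variables (K : comNzRingType) (p n : nat).
Hypothesis chK : p \in [pchar K].
Hypothesis Kfield : forall x : K, x != 0 -> exists y, x * y = 1.
Hypothesis n_gt0 : (0 < n)%N.
Local Notation T := {mpoly K[n]}.

(** If 1 = sum_j phi_j(b_j) with b_j in I^N, the single element
    sum_j b_j^(p^d) x^j has image 1 at level e + d: the powers x^j with j < p^d
    are part of a basis of T over the subring generated by K and T^(p^d), and K
    retracts onto its p^d-th powers. *)
Lemma trace_ideal_split_elt e N (I : set T) :
  trace_ideal (p ^ e) (ideal_pow I N) 1 ->
  exists d0, forall d, (d0 <= d)%N ->
  exists2 b, ideal_pow I (N * p ^ d) b &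
  exists2 phi, cartier_map (p ^ (e + d)) phi & phi b = 1.
Proof.
have p_gt1 : (1 < p)%N by rewrite prime_gt1 ?(pcharf_prime chK).
have p_gt0 : (0 < p)%N by rewrite ltnW.
have [_ _ IM] := ideal_pow_ideal I N.
move=> /(trace_idealP IM)[k [phi [b [phiC Ib e1]]]].
exists k => d led; pose q := (p ^ d)%N.
have q0 : (0 < q)%N by rewrite expn_gt0 p_gt0.
have ltkq (j : 'I_k) : (j < q)%N.
  apply: leq_trans (ltn_ord j) (leq_trans led _).
  exact/ltnW/ltn_expl.
pose x0 := Ordinal n_gt0.
pose U (j : 'I_k) := mnm_muln (mnm1 x0) j.
have UE (j : 'I_k) i : U j i = ((x0 == i) * j)%N by rewrite mulmnE mnm1E.
have [pi piC pi1] := frobenius_retraction chK Kfield d.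
have pi0 := cartier_map0 piC.
pose chi j := @mextract K n q pi (U j).
have chiC j : cartier_map q (chi j).
  apply: mextract_cartier => // i; rewrite UE.
  by case: (_ == _); rewrite ?mul1n ?mul0n.
have chiU i j : chi i 'X_[U j] = (i == j)%:R.
  apply/mpolyP => m; rewrite mcoeff_mextract // mcoeffX.
  have [<-|ne_ij] := eqVneq i j.
    have [->|m0] := eqVneq m mnm0.
      rewrite mcoeff1 eqxx; case: eqP => [_|[]]; first by rewrite pi1.
      by apply/mnmP => l; rewrite mnmDE mulmnE mnm0E.
    rewrite mcoeff1 (negbTE m0); case: eqP => // em; case/eqP: m0.
    apply/mnmP => l; move/mnmP/(_ l): em; rewrite mnmDE mulmnE mnm0E.
    move=> /(congr1 (subn^~ (U i l))); rewrite subnn addnK => /esym/eqP.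
    by rewrite muln_eq0 (gtn_eqF q0) orbF => /eqP.
  rewrite mcoeff0; case: eqP => // /mnmP/(_ x0).
  rewrite mnmDE mulmnE !UE eqxx !mul1n => /(congr1 (modn^~ q)).
  by rewrite modnMDl !modn_small // => /val_inj eij; rewrite eij eqxx in ne_ij.
pose b' := \sum_(j < k) b j ^+ q * 'X_[U j].
exists b'.
  apply: (ideal_sum _ (ideal_pow_ideal _ _)) => j.
  by apply: (ideal_mulr _ (ideal_pow_ideal _ _)); apply: ideal_pow_exp.
exists (fun z => \sum_(j < k) phi j (chi j z)).
  apply: cartier_map_bigsum => j; rewrite expnD.
  exact: cartier_map_comp.
rewrite e1; apply: eq_bigr => j _; congr (phi j _).
rewrite (cartier_map_sum _ _ (chiC j)) (bigD1 j) //= big1 => [|i ne_ij].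
  by have [_ ->] := chiC j; rewrite chiU eqxx mulr1 addr0.
by have [_ ->] := chiC j; rewrite chiU eq_sym (negbTE ne_ij) mulr0.
Qed.

End ManyToOne.

Section Splitting.
Variables (T : comNzRingType) (p : nat) (chT : p \in [pchar T]).

Lemma frob_splitsP e b :
  frob_splits chT e b <-> exists2 phi, cartier_map (p ^ e) phi & phi b = 1.
Proof.
split=> [[phi phi1]|[phi [phiD phiM] phi1]].
  exists (phi : T -> T).
    split=> [x y|r x]; first exact: (raddfD phi).
    exact: (linearZ_LR phi r x).
  by have := phi1 1; rewrite scale1r.
pose phi' : frob_push chT e -> T^o := phi.
have phi'D : {morph phi' : x y / x - y}.
  move=> x y; apply/eqP; rewrite eq_sym subr_eq; apply/eqP.
  rewrite -[LHS]/(phi (x : T)) -[in LHS](subrK y x); exact: phiD.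
have phi'Z : scalable phi' by move=> r x; apply: phiM.
pose A := GRing.isZmodMorphism.Build _ _ phi' phi'D.
pose Z := GRing.isScalable.Build _ _ _ _ phi' phi'Z.
pose L : {linear frob_push chT e -> T^o} := HB.pack phi' A Z.
exists L => r; rewrite -[LHS]/(phi (r ^+ (p ^ e) * b)).
by rewrite phiM phi1 mulr1.
Qed.

Variable RR : realType.

Lemma F_pure_pair_trace (I : set T) (t : RR) : F_pure_pair chT I t ->
  exists e0, forall e, (e0 <= e)%N ->
  trace_ideal (p ^ e) (ideal_pow I (Num.truncn (t * (p ^ e - 1)%N%:R))) 1.
Proof.
move=> [e0 He0]; exists e0 => e /He0[b Ib /frob_splitsP[phi phiC <-]].
exact: trace_ideal_cartier.
Qed.

Lemma F_pure_pair_mono (I J : set T) (t : RR) :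
  I `<=` J -> F_pure_pair chT I t -> F_pure_pair chT J t.
Proof.
move=> IJ [e0 He0]; exists e0 => e /He0[b Ib bs]; exists b => //.
exact: (ideal_pow_mono IJ).
Qed.

Lemma fpt_mono (I J : set T) : I `<=` J -> (fpt RR chT I <= fpt RR chT J)%E.
Proof.
move=> IJ; apply: le_ereal_sup => _ [t [t0 It] <-].
by exists t => //; split=> //; apply: F_pure_pair_mono It.
Qed.

End Splitting.

Section FptLower.
Variables (RR : realType) (K : comNzRingType) (p n : nat).
Hypothesis chK : p \in [pchar K].
Hypothesis Kfield : forall x : K, x != 0 -> exists y, x * y = 1.
Hypothesis n_gt0 : (0 < n)%N.
Local Notation T := {mpoly K[n]}.

Lemma F_pure_pair_of_trace e N (I : set T) (t : RR) :
  trace_ideal (p ^ e) (ideal_pow I N) 1 -> 0 < t -> t * (p ^ e)%:R <= N%:R ->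
  F_pure_pair (pchar_mpoly n chK) I t.
Proof.
move=> /(trace_ideal_split_elt chK Kfield n_gt0)[d0 Hd0] t0 tN.
exists (e + d0)%N => e' le_e'.
have le_e : (e <= e')%N by apply: leq_trans le_e'; apply: leq_addr.
have [|b Ib bs] := Hd0 (e' - e)%N; first by rewrite leq_subRL.
exists b; last by apply/frob_splitsP; rewrite subnKC // in bs.
apply: ideal_pow_le Ib; rewrite truncn_le_nat -natr1 natrM.
apply: le_lt_trans (_ : t * (p ^ e')%:R < _).
  by rewrite ler_pM2l // ler_nat leq_subr.
apply: (@le_lt_trans _ _ (N%:R * (p ^ (e' - e))%:R)); last first.
  by rewrite ltrDl ltr01.
rewrite -{1}(subnKC le_e) expnD natrM mulrA.
by apply: ler_wpM2r.
Qed.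

Lemma fpt_ge_trace e N (I : set T) : (0 < N)%N ->
  trace_ideal (p ^ e) (ideal_pow I N) 1 ->
  ((N%:R / (p ^ e)%:R)%:E <= fpt RR (pchar_mpoly n chK) I)%E.
Proof.
move=> N0 IN; have q0 : (0 : RR) < (p ^ e)%:R.
  by rewrite ltr0n expn_gt0 prime_gt0 // (pcharf_prime chK).
apply: ereal_sup_ubound; exists (N%:R / (p ^ e)%:R) => //.
have t0 : (0 : RR) < N%:R / (p ^ e)%:R by rewrite divr_gt0 // ltr0n.
split=> //; apply: F_pure_pair_of_trace IN t0 _.
by rewrite divfK // gt_eqF.
Qed.

Lemma exists_expn_ge (x : RR) : exists e0, forall e, (e0 <= e)%N ->
  x <= (p ^ e)%:R.
Proof.
have p_gt1 : (1 < p)%N by rewrite prime_gt1 ?(pcharf_prime chK).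
exists (Num.truncn x).+1 => e le_e.
apply/ltW/(lt_le_trans (truncnS_gt x)); rewrite ler_nat.
by apply: (leq_trans le_e); apply/ltnW/ltn_expl.
Qed.

(** The gap between floor(t (p^e - 1)) / p^e and t vanishes for large e. *)
Lemma fpt_ge_limit (I : set T) (t : RR) : 0 < t ->
  (exists e0, forall e, (e0 <= e)%N ->
    trace_ideal (p ^ e) (ideal_pow I (Num.truncn (t * (p ^ e - 1)%N%:R))) 1) ->
  (t%:E <= fpt RR (pchar_mpoly n chK) I)%E.
Proof.
move=> t0 [e0 He0]; apply/lee_subgt0Pr => eps eps0.
rewrite -EFinB.
(* With eps p^e >= t + 2 the floor is at least (t - eps) p^e. *)
have [e1 He1] := exists_expn_ge ((t + 2) / eps).
have [e2 He2] := exists_expn_ge (2 / t + 1).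
pose e := (e0 + e1 + e2)%N; pose N := Num.truncn (t * (p ^ e - 1)%N%:R).
have pe_gt0 : (0 < p ^ e)%N by rewrite expn_gt0 prime_gt0 // (pcharf_prime chK).
have q0 : (0 : RR) < (p ^ e)%:R by rewrite ltr0n.
have Nlt : t * ((p ^ e)%:R - 1) < N%:R + 1.
  by have := truncnS_gt (t * (p ^ e - 1)%N%:R); rewrite -/N -natr1 natrB.
have N0 : (0 < N)%N.
  rewrite truncn_gt0 natrB //; have := He2 e (leq_addl _ _).
  rewrite -lerBrDr ler_pdivrMr // [_ * t]mulrC; apply: le_trans.
  by rewrite ler1n.
have IN : trace_ideal (p ^ e) (ideal_pow I N) 1.
  by apply: He0; rewrite /e -addnA leq_addr.
apply: le_trans (fpt_ge_trace N0 IN).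
rewrite lee_fin ler_pdivlMr //.
have le1 : t + 2 <= eps * (p ^ e)%:R.
  have := He1 e; rewrite ler_pdivrMr // mulrC; apply.
  by rewrite /e addnAC leq_addl.
rewrite mulrBl; move: Nlt; rewrite mulrBr mulr1 ltrBlDr => /ltW.
rewrite lerBlDr => /le_trans; apply; rewrite -addrA lerD2l.
by apply: le_trans le1; rewrite addrC lerD2l ler1n.
Qed.

End FptLower.

(** * Comparing the generic linkage with the given ideal *)

Lemma mpoly_morph_ext (R T : comNzRingType) n
    (phi psi : {rmorphism {mpoly R[n]} -> T}) :
    (forall a, phi (mpolyC n a) = psi (mpolyC n a)) ->
    (forall i, phi ('X_i) = psi ('X_i)) ->
  phi =1 psi.
Proof.
move=> eqC eqX; elim/mpolyind => [|a m q _ _ IH]; first by rewrite !rmorph0.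
rewrite !rmorphD IH -mul_mpolyC !rmorphM eqC; congr (_ * _ + _).
rewrite mpolyXE_id !rmorph_prod; apply: eq_bigr => i _.
by rewrite !rmorphXn eqX.
Qed.

Lemma mxvec_index_eq m n (i i' : 'I_m) (j j' : 'I_n) :
  (mxvec_index i j == mxvec_index i' j') = (i == i') && (j == j').
Proof.
apply/eqP/andP => [|[/eqP -> /eqP ->]//].
have [g gK _] := curry_mxvec_bij m n.
move=> /(congr1 g); rewrite (gK (i, j)) ?(gK (i', j')) //.
by case=> -> ->; rewrite !eqxx.
Qed.

Section LinearForms.
Variables (R : comNzRingType) (p c r : nat) (f : 'I_r -> R).
Hypothesis chR : p \in [pchar R].
Local Notation Ru := {mpoly R[c * r]}.
Local Notation var i j := (@mxvec_index c r i j).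

Definition lin_form (i : 'I_c) : Ru :=
  \sum_(j < r) 'X_(var i j) * mpolyC _ (f j).

Lemma mderiv_lin_form i j i' :
  mderiv (var i j) (lin_form i') = (i' == i)%:R * mpolyC _ (f j).
Proof.
rewrite raddf_sum /= (bigD1 j) //= big1 => [|j' ne_j].
  rewrite mderivM mderivX mderivC mulr0 !addr0 mnm1E mxvec_index_eq eqxx andbT.
  case: (eqVneq i' i) => [->|_]; last by rewrite scale0r !mul0r.
  have -> : mnm_sub (mnm1 (var i j)) (mnm1 (var i j)) = mnm0.
    by apply/mnmP => l; rewrite mnmBE subnn mnm0E.
  by rewrite mpolyX0 scale1r.
rewrite mderivM mderivX mderivC mulr0 addr0 mnm1E mxvec_index_eq.
by rewrite (negbTE ne_j) andbF scale0r mul0r.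
Qed.

Lemma mderiv_lin_prod i j (l : seq 'I_c) :
  mderiv (var i j) (\prod_(i' <- l) lin_form i') * lin_form i =
  (count_mem i l)%:R * mpolyC _ (f j) * \prod_(i' <- l) lin_form i'.
Proof.
elim: l => [|a l IH]; first by rewrite big_nil mderivC !mul0r.
rewrite big_cons mderivM mulrDl -[X in _ + X]mulrA IH mderiv_lin_form /= natrD.
have [->|_] := eqVneq a i; last by rewrite !mul0r !add0r mulrCA !mulrA.
rewrite !mul1r !mulrDl mul1r mulrAC -!mulrA; congr (_ + _).
by rewrite !(mulrCA (lin_form i)).
Qed.

Lemma mcoeff_lin_prod_deg (l : seq 'I_c) m : mdeg m != size l ->
  (\prod_(i <- l) lin_form i)@_m = 0.
Proof.
elim: l m => [|a l IH] m.
  rewrite mdeg_eq0 big_nil mcoeff1 => /negbTE -> //.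
rewrite big_cons mulr_suml raddf_sum /= => dm; rewrite big1 // => j _.
rewrite -mulrA mulrC; have [le_m|] := boolP (lem (mnm1 (var a j)) m).
  rewrite -(submK le_m) addmC mcoeffMX mcoeffCM IH ?mulr0 //.
  by apply: contra dm => /eqP dm; rewrite -(submK le_m) mdegD mdeg1 dm addn1.
exact: mcoeffMX_ngt.
Qed.

Lemma natr_inv_pchar a : (0 < a < p)%N -> exists v, (v * a)%:R = 1 :> R.
Proof.
case/andP=> a_gt0 lt_ap; have p_pr := pcharf_prime chR.
have cop : coprime a p by rewrite coprime_sym prime_coprime // gtnNdvd.
case: (egcdnP p a_gt0) => u v; rewrite (eqP cop) => e _.
by exists u; rewrite e natrD natrM (pcharf0 chR) mulr0 add0r.
Qed.

(** The coefficient is a multinomial coefficient times the product of the f_j.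
    Differentiating with respect to one variable at a time shows that it can
    be inverted as long as every linear form occurs less than p times. *)
Lemma mcoeff_lin_prod (s : seq ('I_c * 'I_r)) :
    (forall i, count_mem i (unzip1 s) < p)%N ->
  exists w : nat,
    w%:R * (\prod_(i <- unzip1 s) lin_form i)
      @_(\big[mnm_add/mnm0]_(ij <- s) mnm1 (var ij.1 ij.2)) =
    \prod_(j <- unzip2 s) f j.
Proof.
elim: s => [|[i j] s IH] lt_p.
  by exists 1%N; rewrite !big_nil mcoeff1 eqxx mulr1.
have [|w Ew] := IH.
  by move=> a; apply: leq_ltn_trans (lt_p a); rewrite leq_addl.
rewrite !big_cons /=; set D := bigop _ _ _ in Ew *; set G := bigop _ _ _ in Ew *.
have [v Ev] : exists v, (v * (count_mem i (unzip1 s)).+1)%:R = 1 :> R.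
  by apply: natr_inv_pchar; have := lt_p i; rewrite /= eqxx.
have dG : mderiv (var i j) (lin_form i * G) =
    (count_mem i (unzip1 s)).+1%:R * (mpolyC _ (f j) * G).
  rewrite mderivM mderiv_lin_form eqxx mul1r [lin_form i * _]mulrC.
  by rewrite mderiv_lin_prod -mulrA -[X in X + _]mul1r -mulrDl nat1r.
exists (v * w * (D (var i j)).+1)%N.
rewrite addmC natrM -mulrA [X in _ * X]mulr_natl -mcoeff_deriv dG.
rewrite -mpolyC_nat !mcoeffCM natrM mulrACA mulrA mulrACA -natrM Ev mul1r.
by rewrite -Ew mulrCA mulrA.
Qed.

End LinearForms.

Lemma count_divn_iota d M i : (0 < d)%N ->
  (count (fun k => k %/ d == i)%N (iota 0 M) <= d)%N.
Proof.
move=> d_gt0; rewrite -size_filter -[X in (_ <= X)%N](size_iota (i * d)).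
apply: uniq_leq_size; first by rewrite filter_uniq ?iota_uniq.
move=> k; rewrite mem_filter !mem_iota => /andP[/eqP <- _].
by rewrite leq_divM {1}(divn_eq k d) ltn_add2l ltn_pmod.
Qed.

Section Linkage.
Variables (K : comNzRingType) (n c r : nat) (f : 'I_r -> {mpoly K[n]}).
Local Notation R := {mpoly K[n]}.
Local Notation S := {mpoly K[n + c * r]}.
Local Notation tg := (@to_generic K n c r).

HB.instance Definition _ := GRing.RMorphism.copy tg
  (comp_mpoly [tuple mpolyX K (mnm1 (lshift (c * r) i)) | i < n]).

Lemma to_genericC a : tg (mpolyC n a) = mpolyC _ a.
Proof. exact: comp_mpolyC. Qed.

Lemma to_genericX i : tg 'X_i = 'X_(lshift (c * r) i).
Proof. by rewrite /to_generic comp_mpolyXU -tnth_nth tnth_mktuple. Qed.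

Definition u_to_zero : S -> R :=
  mmap (@mpolyC n K)
    (fun k => match split k with inl i => 'X_i | inr _ => 0 end).
HB.instance Definition _ := GRing.RMorphism.copy u_to_zero
  (mmap (@mpolyC n K)
    (fun k => match split k with inl i => 'X_i | inr _ => 0 end)).

Lemma to_genericK : cancel tg u_to_zero.
Proof.
apply: (@mpoly_morph_ext K R n (u_to_zero \o tg) idfun) => [a|i] /=.
  by rewrite to_genericC /u_to_zero mmapC.
by rewrite to_genericX /u_to_zero mmapX mmap1U (unsplitK (inl i)).
Qed.

(** Specialising u to 0 turns a map on S into a map on R, and the generators
    of L lie in the extension of I. *)
Lemma trace_linkage_sub q N :
  trace_ideal q (ideal_pow (ideal_gen (range (generic_g c f))) N) 1 ->
  trace_ideal q (ideal_pow (ideal_gen (range f)) N) 1.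
Proof.
set I := ideal_gen (range f); have Iid := @trace_ideal_ideal _ q (ideal_pow I N).
rewrite -[X in _ -> trace_ideal _ _ X](rmorph1 u_to_zero).
pose Z := [set x | trace_ideal q (ideal_pow I N) (u_to_zero x)].
have Zid : is_ideal Z by apply: ideal_preim.
have le_L : ideal_gen (range (generic_g c f)) `<=`
            ideal_gen (range (fun j => tg (f j))).
  apply: ideal_gen_min; first exact: ideal_gen_ideal.
  move=> _ [i _ <-]; apply: (ideal_sum _ (ideal_gen_ideal _)) => j.
  have [_ _ IM] := ideal_gen_ideal (range (fun j => tg (f j))).
  by apply: IM; apply: sub_ideal_gen; exists j.
apply: (@trace_ideal_min S q _ Z Zid _ 1) => phi b phiC Lb.
have {}Lb := ideal_pow_gen (ideal_pow_mono le_L Lb).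
move: b Lb phi phiC.
apply: (@ideal_pow_min S (range (fun j => tg (f j))) N
  [set b | forall phi, cartier_map q phi -> Z (phi b)]).
  exact: cartier_preim_ideal.
move=> g fg phi phiC /=.
have /choice[s sE] : forall k, exists j, tg (f j) = g k.
  by move=> k; case: (fg k) => j _ <-; exists j.
have -> : \prod_(k < N) g k = tg (\prod_(k < N) f (s k)).
  by rewrite rmorph_prod; apply: eq_bigr => k _; rewrite /= sE.
pose psi x := u_to_zero (phi (tg x)).
rewrite -[Z _]/(trace_ideal q (ideal_pow I N) (psi (\prod_(k < N) f (s k)))).
apply: trace_ideal_cartier; last first.
  by apply: ideal_pow_prod => k; apply: sub_ideal_gen; exists (s k).
case: phiC => phiD phiM; split=> [x y|a x]; rewrite /psi.
  by rewrite rmorphD phiD rmorphD.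
by rewrite rmorphM rmorphXn phiM rmorphM /= to_genericK.
Qed.

Local Notation Ru := {mpoly R[c * r]}.

Definition split_vars : S -> Ru :=
  mmap (@mpolyC (c * r) R \o @mpolyC n K)
    (fun k => match split k with inl i => mpolyC _ 'X_i | inr j => 'X_j end).
HB.instance Definition _ := GRing.RMorphism.copy split_vars
  (mmap (@mpolyC (c * r) R \o @mpolyC n K)
    (fun k => match split k with inl i => mpolyC _ 'X_i | inr j => 'X_j end)).

Definition join_vars : Ru -> S := mmap tg (fun j => 'X_(rshift n j)).
HB.instance Definition _ := GRing.RMorphism.copy join_vars
  (mmap tg (fun j => 'X_(rshift n j))).

Lemma split_varsK : cancel split_vars join_vars.
Proof.
apply: (@mpoly_morph_ext K S _ (join_vars \o split_vars) idfun) => [a|i] /=.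
  by rewrite /split_vars mmapC /join_vars mmapC /= to_genericC.
rewrite /split_vars mmapX mmap1U /join_vars -[i in RHS]splitK.
case: (split i) => j /=; first by rewrite mmapC /= to_genericX.
by rewrite mmapX mmap1U.
Qed.

Lemma split_vars_generic x : split_vars (tg x) = mpolyC _ x.
Proof.
move: x; apply: (@mpoly_morph_ext K Ru _ (split_vars \o tg) (@mpolyC _ R)) => [a|i] /=.
  by rewrite to_genericC /split_vars mmapC.
by rewrite to_genericX /split_vars mmapX mmap1U (unsplitK (inl i)).
Qed.

Lemma split_vars_g i : split_vars (generic_g c f i) = lin_form f i.
Proof.
rewrite rmorph_sum; apply: eq_bigr => j _.
rewrite rmorphM /= split_vars_generic.
congr (_ * _); rewrite /generic_u /split_vars mmapX mmap1U.
by rewrite (unsplitK (inr _)).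
Qed.

Variable p : nat.
Hypothesis chK : p \in [pchar K].

(** A product of M generators f_j appears in a product of M forms g_i, with
    an invertible coefficient, provided that no g_i is used p times; there is
    room for this when M <= c (p - 1).  Taking that coefficient gives a map
    on S that reproduces on L^M what the given map does on I^M. *)
Lemma trace_linkage_sup e M : (0 < e)%N -> (M <= c * p.-1)%N ->
  trace_ideal (p ^ e) (ideal_pow (ideal_gen (range f)) M) 1 ->
  trace_ideal (p ^ e) (ideal_pow (ideal_gen (range (generic_g c f))) M) 1.
Proof.
move=> e_gt0 leM; set L := ideal_gen (range (generic_g c f)).
have p_pr := pcharf_prime chK; have p_gt1 := prime_gt1 p_pr.
have chR := pchar_mpoly n chK; have q_gt0 : (0 < p ^ e)%N.
  by rewrite expn_gt0 prime_gt0.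
have Lid := @trace_ideal_ideal _ (p ^ e) (ideal_pow L M).
rewrite -[X in _ -> trace_ideal _ _ X](rmorph1 tg).
move=> /trace_ideal_min => /(_ [set x | trace_ideal (p ^ e) (ideal_pow L M) (tg x)]).
apply; first exact: ideal_preim.
move=> phi b phiC /ideal_pow_gen Ib; move: b Ib phi phiC.
apply: (@ideal_pow_min R (range f) M [set b | forall phi, cartier_map (p ^ e) phi ->
  trace_ideal (p ^ e) (ideal_pow L M) (tg (phi b))]).
  apply: (@cartier_preim_ideal _ _
    [set x | trace_ideal (p ^ e) (ideal_pow L M) (tg x)]).
  exact: ideal_preim.
move=> g fg phi phiC /=.
have /choice[s sE] : forall k, exists j, f j = g k.
  by move=> k; case: (fg k) => j _ <-; exists j.
have p1_gt0 : (0 < p.-1)%N by rewrite -ltnS prednK // ltnW.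
have row_lt (k : 'I_M) : (k %/ p.-1 < c)%N.
  by rewrite ltn_divLR // (leq_trans (ltn_ord k)).
(* Rows are filled one after the other, p - 1 factors in each. *)
pose row k := Ordinal (row_lt k).
pose l := [seq (row k, s k) | k <- index_enum 'I_M].
have l_lt i : (count_mem i (unzip1 l) < p)%N.
  rewrite -[X in (_ < X)%N]prednK ?(ltnW p_gt1) // ltnS.
  rewrite /unzip1 -map_comp count_map.
  apply: leq_trans (count_divn_iota M i p1_gt0).
  rewrite -val_enum_ord count_map /index_enum -enumT.
  by apply: sub_count => k /= /eqP <-.
have [w Ew] := mcoeff_lin_prod f chR l_lt.
set D := bigop _ _ _ in Ew; set G := bigop _ _ _ in Ew.
have D_lt x : (D x < p ^ e)%N.
  apply: (@leq_trans p); last first.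
    by rewrite -{1}[p]expn1 leq_exp2l.
  case/mxvec_indexP: x => i j; apply: leq_ltn_trans (l_lt i).
  rewrite mnm_sumE /unzip1 count_map -sum1_count [X in (_ <= X)%N]big_mkcond /=.
  apply: leq_sum => -[i' j'] _ /=; rewrite mnm1E mxvec_index_eq.
  by case: (i' == i); case: (j' == j).
have degD : mdeg D = size (unzip1 l).
  rewrite mdeg_sum size_map -sum1_size; apply: eq_bigr => ij _.
  by rewrite mdeg1.
have GE : G = split_vars (\prod_(k < M) generic_g c f (row k)).
  rewrite /G /unzip1 -map_comp big_map rmorph_prod.
  by apply: eq_bigr => k _; rewrite /= split_vars_g.
pose phi' x := phi (w%:R * x).
have phi'C : cartier_map (p ^ e) phi' by apply: cartier_map_mull.
pose psi x := join_vars (mextract (p ^ e) phi' D (split_vars x)).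
have -> : tg (phi (\prod_(k < M) g k)) =
    psi (\prod_(k < M) generic_g c f (row k)).
  rewrite /psi -GE.
  have -> : mextract (p ^ e) phi' D G = mpolyC _ (phi (\prod_(k < M) g k)).
    apply/mpolyP => m; rewrite mcoeff_mextract ?(cartier_map0 phi'C) // mcoeffC.
    have [->|m0] := eqVneq m mnm0.
      have -> : exp_shift (p ^ e) D mnm0 = D.
        by apply/mnmP => x; rewrite mnmDE mulmnE mnm0E.
      rewrite /phi' Ew mulr1 /unzip2 -map_comp big_map; congr (phi _).
      by apply: eq_bigr => k _; rewrite /= sE.
    rewrite mcoeff_lin_prod_deg ?mulr0 ?(cartier_map0 phi'C) //.
    rewrite mdegD degD mdegMn -[X in _ != X]add0n eqn_add2r.
    by rewrite muln_eq0 mdeg_eq0 negb_or m0 -lt0n.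
  by rewrite /join_vars mmapC.
apply: trace_ideal_cartier; last first.
  by apply: ideal_pow_prod => k; apply: sub_ideal_gen; exists (row k).
have [extD extM] := mextract_cartier chR D_lt phi'C.
split=> [x y|a x]; rewrite /psi.
  by rewrite rmorphD extD rmorphD.
by rewrite rmorphM rmorphXn extM rmorphM /= split_varsK.
Qed.

End Linkage.

(** * From level e to level 1 *)

(** Rounding the exponents of a monomial in r generators down to multiples of
    Q loses less than r Q; what is left is a Q-th power, and a map that is
    linear over (p Q)-th powers becomes linear over p-th powers when it is
    composed with x |-> x^Q. *)
Lemma trace_ideal_level (T : comNzRingType) (r p e N : nat) (f : 'I_r -> T)
    (Q := (p ^ e)%N) : p \in [pchar T] ->
  trace_ideal (p ^ e.+1) (ideal_pow (ideal_gen (range f)) N) 1 ->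
  trace_ideal p (ideal_pow (ideal_gen (range f)) (N %/ Q - r)) 1.
Proof.
move=> chT; set M := (N %/ Q - r)%N; set I := ideal_gen (range f).
have Q_gt0 : (0 < Q)%N by rewrite expn_gt0 prime_gt0 // (pcharf_prime chT).
move=> /trace_ideal_min; apply; first exact: trace_ideal_ideal.
move=> phi b phiC /ideal_pow_gen Ib; move: b Ib phi phiC.
apply: (@ideal_pow_min T (range f) N [set b | forall phi, cartier_map (p ^ e.+1) phi ->
  trace_ideal p (ideal_pow I M) (phi b)]).
  exact/cartier_preim_ideal/trace_ideal_ideal.
move=> g fg phi phiC /=.
have /choice[s sE] : forall k, exists j, f j = g k.
  by move=> k; case: (fg k) => j _ <-; exists j.
pose a j := #|[set k | s k == j]%SET|.
have gE : \prod_(k < N) g k = \prod_(j < r) f j ^+ a j.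
  rewrite (eq_bigr (fun k => f (s k))) => [|k _]; last by rewrite sE.
  rewrite (partition_big s predT) //=; apply: eq_bigr => j _.
  rewrite (eq_bigr (fun=> f j)) => [|k /eqP -> //].
  by rewrite prodr_const; congr (_ ^+ _); apply: eq_card => k; rewrite inE.
have aN : (\sum_(j < r) a j = N)%N.
  rewrite -[RHS]card_ord -sum1_card (partition_big s predT) //=.
  apply: eq_bigr => j _; rewrite sum1_card.
  by apply: eq_card => k; rewrite inE.
pose d j := (a j %/ Q)%N.
have leM : (M <= \sum_(j < r) d j)%N.
  rewrite leq_subLR -ltnS ltn_divLR // -aN.
  apply: (@leq_ltn_trans (\sum_(j < r) (d j + 1) * Q)).
    apply: leq_sum => j _; rewrite addn1; apply/ltnW.
    by rewrite -ltn_divLR.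
  rewrite -big_distrl big_split /= sum1_card card_ord addnC.
  by rewrite ltn_pmul2r.
have fE : \prod_(j < r) f j ^+ a j =
   \prod_(j < r) f j ^+ (a j %% Q) * (\prod_(j < r) f j ^+ d j) ^+ Q.
  rewrite -prodrXl -big_split; apply: eq_bigr => j _.
  by rewrite /= -exprM -exprD addnC -divn_eq.
rewrite gE fE.
pose psi x := phi (\prod_(j < r) f j ^+ (a j %% Q) * x ^+ Q).
rewrite -[phi _]/(psi _); apply: trace_ideal_cartier.
  case: phiC => phiD phiM; split=> [x y|z x]; rewrite /psi.
    by rewrite exprD_pchar // mulrDr phiD.
  by rewrite exprMn -exprM -expnS mulrCA phiM.
apply: ideal_pow_le leM _ _.
elim/big_ind2: _ => [|x j y k|j _].
- exact: ideal_pow0.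
- exact: ideal_pow_mul.
have := @ideal_pow_exp T I 1 (f j) (d j); rewrite mul1n; apply.
by apply: ideal_pow1; do 2 apply: sub_ideal_gen; exists j.
Qed.

(** * Prime ideals of a polynomial ring *)

Lemma prime_ideal_ideal (T : comNzRingType) (P : set T) :
  prime_ideal P -> is_ideal P.
Proof. by case. Qed.

(** Up to denominators outside P: the maximal ideal of the localization T_P is
    generated by a elements of P. *)
Definition locally_generated (T : comNzRingType) (P : set T) a :=
  exists g : 'I_a -> T, (forall i, P (g i)) /\
    forall f, P f -> exists h, ~ P h /\ ideal_gen (range g) (h * f).

Section PolyPrime.
Variable R : comNzRingType.
Implicit Types (Q : set R) (P : set {poly R}).

Definition coef_ideal Q : set {poly R} := [set f | forall i, Q f`_i].
Definition const_ideal P : set R := [set a | P a%:P].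

Lemma coef_ideal_sub P f :
  is_ideal P -> coef_ideal (const_ideal P) f -> P f.
Proof.
move=> Pid Pf; rewrite -[f]coefK poly_def; apply: ideal_sum => // i.
by rewrite -mul_polyC; apply: ideal_mulr => //; apply: Pf.
Qed.

Lemma prime_coef_ideal Q : prime_ideal Q -> prime_ideal (coef_ideal Q).
Proof.
move=> Qp; have [Qid Q1 QM] := Qp; have [Q0 QD _] := Qid; split.
- split=> [i|x y Qx Qy i|a x Qx i]; first by rewrite coef0.
    by rewrite coefD; apply: QD; [apply: Qx | apply: Qy].
  rewrite coefM; apply: ideal_sum => // j.
  by rewrite mulrC; apply: ideal_mulr.
- by move=> /(_ 0%N); rewrite coef1.
move=> x y Qxy; apply: contrapT => /not_orP[/existsNP nx /existsNP ny].
have nx' : exists i, `[< ~ Q x`_i >] by case: nx => i /asboolP; exists i.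
have ny' : exists j, `[< ~ Q y`_j >] by case: ny => j /asboolP; exists j.
case: (ex_minnP nx') => i /asboolP nQi mini.
case: (ex_minnP ny') => j /asboolP nQj minj.
have Qlt k : (k < i)%N -> Q x`_k.
  by move=> lt; apply: contrapT => /asboolP /mini; rewrite leqNgt lt.
have Qlt' k : (k < j)%N -> Q y`_k.
  by move=> lt; apply: contrapT => /asboolP /minj; rewrite leqNgt lt.
have lt_i : (i < (i + j).+1)%N by rewrite ltnS leq_addr.
have := Qxy (i + j)%N; rewrite coefM (bigD1 (Ordinal lt_i)) //= addKn.
move=> Qsum; suff : Q (x`_i * y`_j) by case/QM.
rewrite -[_ * _](addrK (\sum_(k < (i + j).+1 | k != Ordinal lt_i)
  x`_k * y`_(i + j - k))).
apply: ideal_sub => //; rewrite big_mkcond; apply: ideal_sum => // k.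
case: eqVneq => //= ne_k.
have [lt_ki|le_ik] := ltnP k i; first by apply: ideal_mulr => //; apply: Qlt.
rewrite mulrC; apply: ideal_mulr => //; apply: Qlt'.
have lt_ik : (i < k)%N.
  rewrite ltn_neqAle le_ik andbT.
  by apply: contra ne_k => /eqP e; apply/eqP/val_inj.
by rewrite ltn_subLR ?ltn_add2r // -ltnS.
Qed.

Lemma size_drop_lead (f : {poly R}) : f != 0 ->
  (size (f - (lead_coef f)%:P * 'X^((size f).-1))%R < size f)%N.
Proof.
rewrite -size_poly_gt0 => sf.
rewrite -[X in (_ < X)%N]prednK // ltnS; apply/leq_sizeP => j lej.
rewrite coefB coefCM coefXn; case: eqP => [->|/eqP ne_j].
  by rewrite mulr1 subrr.
rewrite mulr0 subr0; apply: nth_default.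
by rewrite -(prednK sf) ltn_neqAle eq_sym ne_j.
Qed.

(** The bound on the quotient is what makes this version useful over a ring
    with zero divisors. *)
Lemma pseudo_division (g f : {poly R}) : (0 < size g)%N ->
  exists k q r, [/\ (lead_coef g ^+ k)%:P * f = q * g + r,
    (size r < size g)%N & (size q <= (size f).+1 - size g)%N].
Proof.
move=> g0; have [n] := ubnP (size f); elim: n f => // n IH f; rewrite ltnS => lef.
have [lt|ge] := ltnP (size f) (size g).
  by exists 0%N, 0, f; rewrite mul1r mul0r add0r size_poly0.
have f0 : f != 0 by rewrite -size_poly_gt0 (leq_trans g0).
pose d := (size f - size g)%N; pose m := (lead_coef f)%:P * 'X^d.
have sub_lt : (size ((lead_coef g)%:P * f - m * g)%R < size f)%N.
  rewrite -size_poly_gt0 in f0.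
  rewrite -[X in (_ < X)%N]prednK // ltnS; apply/leq_sizeP => j lej.
  rewrite coefB coefCM -mulrA coefCM coefXnM ltnNge.
  have led : (d <= j)%N.
    apply: leq_trans lej; rewrite -ltnS prednK // ltn_subrL.
    by rewrite g0.
  rewrite led /=; move: lej; rewrite leq_eqVlt => /orP[/eqP <-|lt_j].
    have -> : ((size f).-1 - d = (size g).-1)%N.
      by rewrite /d -subn1 subnAC subKn // subn1.
    by rewrite mulrC subrr.
  rewrite !nth_default ?mulr0 ?subrr //.
    by rewrite leq_subRL // subnK // -(prednK f0).
  by rewrite -(prednK f0).
have [k [q [r [e sr sq]]]] := IH _ (leq_trans sub_lt lef).
exists k.+1, (q + (lead_coef g ^+ k)%:P * m), r; split=> //.
  rewrite exprSr polyCM -mulrA mulrDl addrAC -e mulrBr.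
  by rewrite !mulrA subrK.
apply: leq_trans (size_polyD _ _) _; rewrite geq_max; apply/andP; split.
  by apply: leq_trans sq _; apply: leq_sub2r; apply: leqW.
rewrite mulrA -polyCM; apply: leq_trans (size_polyMleq _ _) _.
rewrite size_polyXn addnS /= subSn //.
by rewrite -add1n leq_add2r size_polyC_leq1.
Qed.

Variable P : set {poly R}.
Hypothesis Pprime : prime_ideal P.
Local Notation Q := (const_ideal P).

Let Pid : is_ideal P. Proof. by case: Pprime. Qed.

Lemma prime_const_ideal : prime_ideal Q.
Proof. exact: (prime_ideal_preim (@polyC R)). Qed.

(** A polynomial of least size in P outside Q[X] defines X as an algebraic
    element modulo P. *)
Lemma prime_poly_dichotomy :
  (P `<=` coef_ideal Q) \/
  exists g, [/\ P g, ~ Q (lead_coef g), (1 < size g)%N &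
    forall f, P f -> (size f < size g)%N -> coef_ideal Q f].
Proof.
have [|] := pselect (P `<=` coef_ideal Q); first by left.
move=> /existsNP[f0 /not_implyP[Pf0 nf0]]; right.
pose A k := `[< exists f, [/\ P f, ~ coef_ideal Q f & size f = k] >].
have exA : exists k, A k by exists (size f0); apply/asboolP; exists f0.
case: (ex_minnP exA) => k /asboolP[g [Pg ng sg]] mink.
have ming f : P f -> (size f < size g)%N -> coef_ideal Q f.
  move=> Pf; rewrite sg => lt; apply: contrapT => nf.
  have /mink : A (size f) by apply/asboolP; exists f.
  by rewrite leqNgt lt.
have Qid := prime_ideal_ideal prime_const_ideal.
have [Q0 QD _] := Qid.
have nlead : ~ Q (lead_coef g).
  move=> Ql; apply: (ng) => i.
  have g0 : g != 0 by apply/eqP => g0; apply: ng => j; rewrite g0 coef0.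
  pose f := g - (lead_coef g)%:P * 'X^((size g).-1).
  have Pf : P f by apply: ideal_sub => //; apply: ideal_mulr.
  have sf : (size f < size g)%N by apply: size_drop_lead.
  have -> : g`_i = f`_i + lead_coef g * (i == (size g).-1)%:R.
    by rewrite coefB coefCM coefXn subrK.
  by apply: QD; [apply: ming | apply: ideal_mulr].
exists g; split=> //; rewrite ltnNge; apply/negP => /size1_polyC eg.
by apply: nlead; rewrite eg lead_coefC; rewrite /const_ideal /= -eg.
Qed.

Lemma coef_ideal_clear a (g : 'I_a -> R) (f : {poly R}) :
    (forall x, Q x -> exists h, ~ Q h /\ ideal_gen (range g) (h * x)) ->
    coef_ideal Q f ->
  exists h, ~ Q h /\ ideal_gen (range (fun i => (g i)%:P)) (h%:P * f).
Proof.
move=> gQ Qf; set J := ideal_gen _; have Jid : is_ideal J.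
  exact: ideal_gen_ideal.
have gJ x : ideal_gen (range g) x -> J x%:P.
  move: x; apply: (@ideal_gen_min _ [set x | J x%:P]).
    exact: (ideal_preim (@polyC R)).
  by move=> _ [i _ <-]; apply: sub_ideal_gen; exists i.
have /choice[H HP] : forall i, exists h, ~ Q h /\ ideal_gen (range g) (h * f`_i).
  by move=> i; apply: gQ.
exists (\prod_(i < size f) H i); split.
  apply: prime_ideal_prod; first exact: prime_const_ideal.
  by move=> i; case: (HP i).
rewrite -[f in _ * f]coefK poly_def mulr_sumr; apply: (ideal_sum _ Jid) => i.
rewrite -mul_polyC mulrA -polyCM; apply: (ideal_mulr _ Jid); apply: gJ.
rewrite (bigD1 i) //= mulrAC; apply: (ideal_mulr _ (ideal_gen_ideal _)).
by case: (HP i).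
Qed.

Lemma locally_generated_poly a : locally_generated Q a ->
  P `<=` coef_ideal Q -> locally_generated P a.
Proof.
move=> [g [Qg gQ]] PQ; exists (fun i => (g i)%:P); split=> // f /PQ Qf.
by have [h [nh hf]] := coef_ideal_clear gQ Qf; exists h%:P.
Qed.

Lemma locally_generated_polyS a : locally_generated Q a ->
  ~ (P `<=` coef_ideal Q) -> locally_generated P a.+1.
Proof.
move=> [g [Qg gQ]] nPQ.
have [//|[g0 [Pg0 nl sg0 ming]]] := prime_poly_dichotomy.
pose g' (i : 'I_a.+1) := if unlift ord0 i is Some j then (g j)%:P else g0.
exists g'; split=> [i|f Pf]; first by rewrite /g'; case: unliftP => [j|] _; [apply: Qg|].
have [k [q [r [e sr _]]]] := pseudo_division f (ltnW sg0).
have Pr : P r.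
  have -> : r = (lead_coef g0 ^+ k)%:P * f - q * g0 by rewrite e addrC addKr.
  by have [_ _ PM] := Pid; apply: (ideal_sub Pid); apply: PM.
have [h [nh hr]] := coef_ideal_clear gQ (ming _ Pr sr).
exists (h%:P * (lead_coef g0 ^+ k)%:P); split.
  have [_ _ PM] := Pprime; case/PM => //; rewrite rmorphXn /=.
  by move/(prime_ideal_exp Pprime).
rewrite -mulrA e mulrDr.
have Jid := ideal_gen_ideal (range g'); have [_ JD JM] := Jid; apply: JD.
  rewrite mulrA; apply: JM; apply: sub_ideal_gen; exists ord0 => //.
  by rewrite /g' unlift_none.
move: hr; apply: ideal_gen_mono => _ [j _ <-]; exists (lift ord0 j) => //.
by rewrite /g' liftK.
Qed.

(** In the algebraic case every element outside P has a multiple that is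
    congruent to an element of R outside Q: a nonconstant multiple of least
    degree would, by division of g by it, yield a smaller one. *)
Lemma prime_poly_norm g b : P g -> ~ Q (lead_coef g) -> (1 < size g)%N ->
  (forall f, P f -> (size f < size g)%N -> coef_ideal Q f) -> ~ P b ->
  exists v b', ~ Q b' /\ P (v * b - b'%:P).
Proof.
move=> Pg nl sg ming nPb; have Qid := prime_ideal_ideal prime_const_ideal.
have [_ PD PM] := Pid; have [_ P1 Pp] := Pprime.
have Qprime := prime_const_ideal.
pose A k := `[< exists v r, [/\ P (v * b - r), ~ P r & size r = k] >].
have exA : exists k, A k.
  exists (size b); apply/asboolP; exists 1, b; rewrite mul1r subrr.
  by split=> //; case: Pid.
case: (ex_minnP exA) => k /asboolP[v [s [Ps nPs <-]]] mins {k}.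
have {}mins w t : P (w * s - t) -> ~ P t -> (size s <= size t)%N.
  move=> Pt nPt; apply: mins; apply/asboolP; exists (w * v), t; split=> //.
  have -> : w * v * b - t = w * (v * b - s) + (w * s - t).
    by rewrite mulrBr addrA subrK mulrA.
  by apply: PD => //; apply: PM.
have P0 : P 0 by case: Pid.
have s0 : s != 0 by apply: contra_notN nPs => /eqP ->.
have s_gt0 : (0 < size s)%N by rewrite size_poly_gt0.
have nls : ~ Q (lead_coef s).
  move=> Ql; have := size_drop_lead s0; rewrite ltnNge => /negP; apply.
  have Pl : P ((lead_coef s)%:P * 'X^((size s).-1)) by apply: ideal_mulr.
  apply: (mins 1); first by rewrite mul1r subKr.
  by move=> Psl; apply: nPs; have := PD _ _ Psl Pl; rewrite subrK.
have nexp (g1 : {poly R}) i : ~ Q (lead_coef g1) -> ~ P (lead_coef g1 ^+ i)%:P.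
  by move=> nl1; rewrite rmorphXn => /(prime_ideal_exp Pprime).
have lt_sg : (size s < size g)%N.
  rewrite ltnNge; apply/negP => le_gs.
  have [i [q [t [e st _]]]] := pseudo_division s (ltnW sg).
  have Pqg : P (q * g) by apply: PM.
  have := leq_trans st le_gs; rewrite ltnNge => /negP; apply.
  apply: (mins (lead_coef g ^+ i)%:P); first by rewrite e addrK.
  move=> Pt; have : P ((lead_coef g ^+ i)%:P * s) by rewrite e; apply: PD.
  by case/Pp => //; apply: nexp.
have [le_s1|lt1s] := leqP (size s) 1.
  have es := size1_polyC le_s1; exists v, s`_0; split; last by rewrite -es.
  by rewrite /const_ideal /= -es.
have [i [q [t [e st sq]]]] := pseudo_division g s_gt0.
have Pt : P t.
  apply: contrapT => nPt; move: st; rewrite ltnNge => /negP; apply.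
  apply: (mins (- q)) => //; rewrite mulNr -opprD -e.
  by apply: ideal_opp => //; apply: PM.
have Pq : P q.
  have : P (q * s).
    by rewrite -(addrK t (q * s)) -e; apply: (ideal_sub Pid) => //; apply: PM.
  by case/Pp.
have lt_qg : (size q < size g)%N.
  apply: leq_ltn_trans sq _; rewrite ltn_subLR ?(ltnW lt_sg) //; last first.
    by apply: leqW; apply: ltnW.
  by rewrite -(ltn_add2r (size g)) add1n in lt1s.
have Qq := ming _ Pq lt_qg.
have : coef_ideal Q (q * s).
  have [[_ _ QM] _ _] := prime_coef_ideal Qprime.
  by rewrite mulrC; apply: QM.
have -> : q * s = (lead_coef s ^+ i)%:P * g - t by rewrite e addrK.
move=> /(_ (size g).-1); rewrite coefB coefCM [t`__]nth_default; last first.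
  by rewrite -ltnS (ltn_predK sg) (leq_trans st) // ltnW.
rewrite subr0 => Ql; have [_ _ Qp] := Qprime.
by case: (Qp _ _ Ql) => // /(prime_ideal_exp Qprime).
Qed.

End PolyPrime.

(** * Extending a specialization *)

Lemma exists_field_root (F : fieldType) (f : {poly F}) : (1 < size f)%N ->
  exists (L : fieldType) (iota : {rmorphism F -> L}) (x : L),
    (map_poly iota f).[x] = 0.
Proof.
move=> sf; pose A k := `[< exists g : {poly F}, [/\ (1 < size g)%N, g %| f
  & size g = k] >].
have exA : exists k, A k by exists (size f); apply/asboolP; exists f.
case: (ex_minnP exA) => _ /asboolP[g [sg gf <-]] ming.
have irr_g : irreducible_poly g.
  split=> // h sh hg; rewrite -dvdp_size_eqp // eqn_leq.
  have g0 : g != 0 by rewrite -size_poly_gt0 ltnW.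
  rewrite dvdp_leq //=; apply: ming; apply/asboolP; exists h; split=> //.
    rewrite ltn_neqAle eq_sym sh size_poly_gt0.
    by apply: contraNneq g0 => h0; rewrite h0 dvd0p in hg.
  exact: dvdp_trans gf.
have [L _ [x gx _]] := irredp_FAdjoin irr_g.
exists L, (in_alg L), x; apply/eqP.
have /dvdpP[h ->] := gf.
by rewrite rmorphM hornerM (eqP gx) mulr0.
Qed.

(** If X is transcendental modulo P it can be sent to a variable over the
    field; if it is algebraic it is sent to a root of its equation g, and then
    b does not vanish because a multiple of it is congruent to b' in R. *)
Lemma extend_specialization (R : comNzRingType) (P : set {poly R}) b :
    prime_ideal P -> ~ P b ->
  exists b', ~ const_ideal P b' /\
  forall (F : fieldType) (theta : {rmorphism R -> F}),
    (forall x, const_ideal P x -> theta x = 0) -> theta b' != 0 ->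
  exists (L : fieldType) (iota : {rmorphism F -> L})
         (theta' : {rmorphism {poly R} -> L}),
    [/\ forall x, theta' x%:P = iota (theta x),
        forall f, P f -> theta' f = 0 & theta' b != 0].
Proof.
move=> Pp nPb; have Pid := prime_ideal_ideal Pp; have [_ _ PM] := Pid.
pose Q := const_ideal P; have [_ PMp] := Pp.
have [PQ|[g [Pg nl sg ming]]] := prime_poly_dichotomy Pp.
  have /existsNP[i nQb] : ~ coef_ideal Q b by move/(coef_ideal_sub Pid).
  exists b`_i; split=> // F theta thetaQ thetab.
  exists {fraction {poly F}}.
  pose iota : {rmorphism F -> {fraction {poly F}}} :=
    @tofrac {poly F} \o @polyC F.
  pose theta' : {rmorphism {poly R} -> {fraction {poly F}}} :=
    @tofrac {poly F} \o map_poly theta.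
  exists iota, theta'; split=> [x|f /PQ Qf|] /=.
  - by rewrite map_polyC.
  - apply/eqP; rewrite tofrac_eq0; apply/eqP/polyP => j.
    by rewrite coef_map coef0; apply/thetaQ/Qf.
  - rewrite tofrac_eq0; apply: contraNneq thetab => b0.
    by have := congr1 (fun q : {poly F} => q`_i) b0; rewrite coef_map coef0 => /= ->.
have [v [b' [nQb' Pvb]]] := prime_poly_norm Pp Pg nl sg ming nPb.
exists (lead_coef g * b'); split.
  by have [_ _ Qm] := prime_const_ideal Pp; move/Qm => [].
move=> F theta thetaQ; rewrite rmorphM mulf_eq0 => /norP[lg0 b'0].
have sg' : (1 < size (map_poly theta g))%N by rewrite size_map_poly_id0.
have [L [iota [x gx]]] := exists_field_root sg'.
pose h : {rmorphism R -> L} := iota \o theta.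
have cx : commr_rmorph h x by move=> y; apply: mulrC.
pose theta' : {rmorphism {poly R} -> L} := horner_morph cx.
have theta'C y : theta' y%:P = iota (theta y) by rewrite /= horner_morphC.
have theta'E f : theta' f = (map_poly iota (map_poly theta f)).[x].
  by rewrite -map_poly_comp.
have theta'Q f : coef_ideal Q f -> theta' f = 0.
  move=> Qf; rewrite theta'E.
  have -> : map_poly theta f = 0.
    by apply/polyP => j; rewrite coef_map coef0; apply/thetaQ/Qf.
  by rewrite rmorph0 horner0.
have theta'P f : P f -> theta' f = 0.
  move=> Pf; have [k [q [r [e sr _]]]] := pseudo_division f (ltnW sg).
  have Pr : P r.
    have -> : r = (lead_coef g ^+ k)%:P * f - q * g by rewrite e addrC addKr.
    by apply: (ideal_sub Pid); apply: PM.
  have := congr1 theta' e; rewrite rmorphD !rmorphM (theta'E g) gx mulr0 add0r.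
  rewrite (theta'Q r (ming _ Pr sr)) theta'C !rmorphXn /= => /eqP.
  by rewrite mulf_eq0 expf_eq0 fmorph_eq0 (negbTE lg0) andbF => /eqP.
exists L, iota, theta'; split=> //.
have := theta'P _ Pvb; rewrite rmorphB rmorphM theta'C => /eqP.
rewrite subr_eq0 => /eqP e; apply: contraNneq b'0 => b0.
by move/eqP: e; rewrite b0 mulr0 eq_sym fmorph_eq0.
Qed.

Section MpolySucc.
Variables (R : comNzRingType) (n : nat).

Definition poly_to_mpoly : {poly {mpoly R[n]}} -> {mpoly R[n.+1]} :=
  horner_eval 'X_ord_max \o map_poly (@mwiden n R).
HB.instance Definition _ := GRing.RMorphism.copy poly_to_mpoly
  (horner_eval ('X_ord_max : {mpoly R[n.+1]}) \o map_poly (@mwiden n R)).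

Lemma poly_to_mpolyC a : poly_to_mpoly a%:P = mwiden a.
Proof. by rewrite /poly_to_mpoly /= map_polyC /horner_eval hornerC. Qed.

Lemma poly_to_mpolyX : poly_to_mpoly 'X = 'X_ord_max.
Proof. by rewrite /poly_to_mpoly /= map_polyX /horner_eval hornerX. Qed.

Lemma muniX_max : muni 'X_ord_max = 'X :> {poly {mpoly R[n]}}.
Proof.
rewrite /muni mmapX mmap1U; case: splitP => [[j lt_j]|j] //= e.
by exfalso; move: lt_j; rewrite -e ltnn.
Qed.

Lemma muniX_widen (i : 'I_n) :
  muni 'X_(widen_ord (leqnSn n) i) = ('X_i)%:P :> {poly {mpoly R[n]}}.
Proof.
rewrite /muni mmapX mmap1U; case: splitP => [j|j] /= e.
  by congr (polyC (mpolyX _ (mnm1 _))); apply: val_inj; rewrite /= -e.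
by move: (ltn_ord i); rewrite e ltnNge leq_addr.
Qed.

Lemma mwidenXU (i : 'I_n) :
  mwiden 'X_i = 'X_(widen_ord (leqnSn n) i) :> {mpoly R[n.+1]}.
Proof. by rewrite mwidenX mnmwiden1. Qed.

Lemma muni_mwiden (a : {mpoly R[n]}) : muni (mwiden a) = a%:P.
Proof.
move: a; apply: (@mpoly_morph_ext R _ n (@muni n R \o @mwiden n R)
  (@polyC _)) => [a|i] /=.
  by rewrite mwidenC muniC.
by rewrite mwidenXU muniX_widen.
Qed.

Lemma muniK (f : {mpoly R[n.+1]}) : poly_to_mpoly (muni f) = f.
Proof.
move: f; apply: (@mpoly_morph_ext R _ n.+1 (poly_to_mpoly \o @muni n R)
  idfun) => [a|i] /=.
  by rewrite muniC poly_to_mpolyC mwidenC.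
case: (unliftP ord_max i) => [j ->|->].
  have -> : lift ord_max j = widen_ord (leqnSn n) j.
    by apply: val_inj; rewrite /= /bump leqNgt ltn_ord.
  by rewrite muniX_widen poly_to_mpolyC mwidenXU.
by rewrite muniX_max poly_to_mpolyX.
Qed.

Lemma poly_to_mpolyK f : muni (poly_to_mpoly f) = f.
Proof.
rewrite -[f in LHS]coefK -[RHS]coefK !poly_def !rmorph_sum.
apply: eq_bigr => i _; rewrite /= -!mul_polyC !rmorphM !rmorphXn /=.
by rewrite poly_to_mpolyC poly_to_mpolyX muni_mwiden muniX_max.
Qed.

Definition contraction (P : set {mpoly R[n.+1]}) : set {mpoly R[n]} :=
  [set a | P (mwiden a)].

Definition extension (Q : set {mpoly R[n]}) : set {mpoly R[n.+1]} :=
  [set f | coef_ideal Q (muni f)].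

Lemma prime_contraction P : prime_ideal P -> prime_ideal (contraction P).
Proof. exact: (@prime_ideal_preim _ _ (@mwiden n R)). Qed.

Lemma prime_extension Q : prime_ideal Q -> prime_ideal (extension Q).
Proof.
move=> Qp; pose mu : {rmorphism {mpoly R[n.+1]} -> {poly {mpoly R[n]}}} :=
  @muni n R.
exact: (prime_ideal_preim mu (prime_coef_ideal Qp)).
Qed.

Lemma extension_mwiden Q a : is_ideal Q -> extension Q (mwiden a) <-> Q a.
Proof.
move=> [Q0 _ _]; rewrite /extension /= muni_mwiden.
split=> [/(_ 0%N)|Qa j]; first by rewrite coefC.
by rewrite coefC; case: ifP.
Qed.

Lemma extension_lt Q Q' : is_ideal Q -> is_ideal Q' -> Q `<` Q' ->
  extension Q `<` extension Q'.
Proof.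
move=> Qid Q'id [le nle]; split=> [f Qf j|ge]; first exact/le/Qf.
by apply: nle => a /(extension_mwiden a Q'id) /ge /(extension_mwiden a Qid).
Qed.

Lemma extension_contraction P : is_ideal P -> extension (contraction P) `<=` P.
Proof.
move=> Pid f Qf; rewrite -[f]muniK.
have := @coef_ideal_sub _ [set f | P (poly_to_mpoly f)] (muni f).
apply; first exact: ideal_preim.
by move=> j; rewrite /const_ideal /= poly_to_mpolyC; apply: Qf.
Qed.

(** A chain below the contraction of P is extended to a chain below P, to which
    P itself can be added when P is not an extended ideal. *)
Lemma height_contraction P a : prime_ideal P ->
  prime_height_ge (contraction P) a -> prime_height_ge P a.
Proof.
move=> Pp [Qs [Qs_prime Qs_lt Qs_top]]; have Pid := prime_ideal_ideal Pp.
exists (fun i => if (i < a)%N then extension (Qs i) else P).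
split=> [i lei|i lti|]; last by rewrite ltnn.
  by case: ifP => _; [exact: prime_extension (Qs_prime _ lei) | exact: Pp].
have lt_ext : extension (Qs i) `<` extension (Qs i.+1).
  have Qid j (lej : (j <= a)%N) := prime_ideal_ideal (Qs_prime _ lej).
  exact: extension_lt (Qid _ (ltnW lti)) (Qid _ lti) (Qs_lt _ lti).
rewrite lti; case: ifP => [_|/negbT]; [exact: lt_ext | rewrite -leqNgt => ge].
have ea : i.+1 = a by apply/eqP; rewrite eqn_leq lti ge.
have le_top : extension (Qs i.+1) `<=` P.
  by rewrite ea Qs_top; apply: extension_contraction.
have [le nle] := lt_ext; split=> [f /le /le_top //|Ple].
by apply: nle => f /le_top /Ple.
Qed.

Lemma height_contractionS P a : prime_ideal P ->
  ~ (P `<=` extension (contraction P)) ->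
  prime_height_ge (contraction P) a -> prime_height_ge P a.+1.
Proof.
move=> Pp nPQ [Qs [Qs_prime Qs_lt Qs_top]]; have Pid := prime_ideal_ideal Pp.
exists (fun i => if (i <= a)%N then extension (Qs i) else P).
split=> [i lei|i|]; last by rewrite ltnn.
  by case: ifP => le; [exact: prime_extension (Qs_prime _ le) | exact: Pp].
rewrite ltnS => le; rewrite le; case: ifP => [lt|/negbT].
  have Qid j (lej : (j <= a)%N) := prime_ideal_ideal (Qs_prime _ lej).
  exact: extension_lt (Qid _ (ltnW lt)) (Qid _ lt) (Qs_lt _ lt).
rewrite -leqNgt => ge; have -> : i = a by apply/eqP; rewrite eqn_leq le.
by rewrite Qs_top; split=> //; apply: extension_contraction.
Qed.

Lemma locally_generated_mpoly P a :
  locally_generated [set f | P (poly_to_mpoly f)] a -> locally_generated P a.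
Proof.
move=> [g [Pg gP]]; exists (fun i => poly_to_mpoly (g i)); split=> // f Pf.
have [|h [nh hf]] := gP (muni f); first by rewrite /= muniK.
exists (poly_to_mpoly h); split=> //; move: hf.
rewrite -[f in poly_to_mpoly h * f]muniK -rmorphM.
move: (h * muni f).
apply: (@ideal_gen_min _ [set f | ideal_gen (range (fun i => poly_to_mpoly (g i)))
  (poly_to_mpoly f)]).
  by apply: ideal_preim; apply: ideal_gen_ideal.
by move=> _ [i _ <-]; apply: sub_ideal_gen; exists i.
Qed.

End MpolySucc.

(** Chevalley's theorem on the image of a morphism, in the form of an extension
    property: away from the zeros of some a, every point of Spec A in the
    closure of the image of V(P) lifts to V(P) minus the zeros of b. *)
Lemma extend_specialization_mpoly n (A : comNzRingType) (P : set {mpoly A[n]}) b :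
    prime_ideal P -> ~ P b ->
  exists a, ~ P (mpolyC n a) /\
  forall (F : fieldType) (theta : {rmorphism A -> F}),
    (forall x, P (mpolyC n x) -> theta x = 0) -> theta a != 0 ->
  exists (L : fieldType) (iota : {rmorphism F -> L})
         (theta' : {rmorphism {mpoly A[n]} -> L}),
    [/\ forall x, theta' (mpolyC n x) = iota (theta x),
        forall f, P f -> theta' f = 0 & theta' b != 0].
Proof.
elim: n P b => [|n IH] P b Pp nPb.
  have fE (f : {mpoly A[0]}) : f = mpolyC 0 f@_mnm0.
    apply/mpolyP => m; have -> : m = mnm0 by apply/mnmP => -[].
    by rewrite mcoeffC eqxx mulr1.
  exists b@_mnm0; rewrite -fE; split=> // F theta thetaP thetab.
  exists F, idfun.
  pose theta' : {rmorphism {mpoly A[0]} -> F} := mmap theta (fun=> 0).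
  have th f : theta' f = theta f@_mnm0 by rewrite [f in LHS]fE /= mmapC.
  exists theta'; split=> [x|f Pf|]; rewrite th ?mcoeffC ?eqxx ?mulr1 //.
  by apply: thetaP; rewrite -fE.
pose s := @poly_to_mpoly A n.
have Ppoly : prime_ideal [set f | P (s f)] by apply: prime_ideal_preim.
have nPpoly : ~ [set f | P (s f)] (muni b) by rewrite /= /s muniK.
have [b' [nQb' ext]] := extend_specialization Ppoly nPpoly.
have Qp := prime_const_ideal Ppoly.
have [a [nQa ext']] := IH _ _ Qp nQb'.
have sC x : s ((mpolyC n x)%:P) = mpolyC n.+1 x.
  by rewrite /s poly_to_mpolyC mwidenC.
exists a; split; first by rewrite -sC.
move=> F theta thetaP thetaa.
have [|L [iota [theta' [thC thQ thb]]]] := ext' F theta _ thetaa.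
  by move=> x Px; apply: thetaP; rewrite -sC.
have [L' [iota' [theta'' [thC' thP thb']]]] := ext L theta' thQ thb.
exists L', (iota' \o iota), (theta'' \o @muni n A); split=> [x|f Pf|//] /=.
  by rewrite muniC thC' thC.
by apply: thP; rewrite /= /s muniK.
Qed.

(** * Height and local generators *)

(** Along the chain of variables, an algebraic variable contributes both a step
    to a chain of primes below P, already over C, and a local generator, over
    the subring A.  The chain consists of the extensions of the contractions
    of P to the polynomial rings in fewer variables. *)
Lemma height_locally_generated n (A : comNzRingType) (C : fieldType)
    (phi : {rmorphism A -> C}) (P : set {mpoly C[n]}) :
    injective phi -> prime_ideal P ->
  exists a, prime_height_ge P a /\
    locally_generated [set f | P (map_mpoly phi f)] a.
Proof.
move=> phi_inj; elim: n P => [|n IH] P Pp.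
  exists 0%N; split; first by exists (fun=> P).
  exists (fun=> 0); split=> [[]//|f Pf]; exists 1; split.
    by rewrite /= rmorph1; case: Pp.
  set J := ideal_gen _; have [J0 _ _] : is_ideal J by apply: ideal_gen_ideal.
  suff -> : f = 0 by rewrite mulr0.
  apply/mpolyP => m; rewrite mcoeff0; have -> : m = mnm0 by apply/mnmP => -[].
  apply/eqP/negP => /negP f0.
  have e : map_mpoly phi f = mpolyC 0 (phi f@_mnm0).
    apply/mpolyP => m'; have -> : m' = mnm0 by apply/mnmP => -[].
    by rewrite mcoeff_map_mpoly mcoeffC eqxx mulr1.
  have [[_ _ PM] P1 _] := Pp; apply: P1.
  have -> : 1 = mpolyC 0 (phi f@_mnm0)^-1 * map_mpoly phi f.
    rewrite e -mpolyCM mulVf ?mpolyC1 //.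
    by rewrite -(rmorph0 phi) (inj_eq phi_inj).
  exact: PM.
have map_widen (x : {mpoly A[n]}) :
    map_mpoly phi (mwiden x) = mwiden (map_mpoly phi x).
  move: x; pose ph1 : {rmorphism {mpoly A[n]} -> {mpoly C[n.+1]}} :=
    map_mpoly phi \o @mwiden n A.
  pose ph2 : {rmorphism {mpoly A[n]} -> {mpoly C[n.+1]}} :=
    @mwiden n C \o map_mpoly phi.
  apply: (@mpoly_morph_ext A _ n ph1 ph2) => [x|i] /=.
    by rewrite mwidenC !map_mpolyC mwidenC.
  by rewrite mwidenXU !map_mpolyX mwidenXU.
have map_s (f : {poly {mpoly A[n]}}) :
    map_mpoly phi (poly_to_mpoly f) =
    poly_to_mpoly (map_poly (map_mpoly phi) f).
  elim/poly_ind: f => [|f x IHf]; first by rewrite !rmorph0.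
  rewrite !rmorphD !rmorphM /= IHf map_polyC map_polyX /=.
  by rewrite !poly_to_mpolyC !poly_to_mpolyX map_widen map_mpolyX.
pose PA := [set f | P (map_mpoly phi f)].
have PAp : prime_ideal PA by apply: prime_ideal_preim.
pose PA' := [set f | PA (poly_to_mpoly f)].
have PA'p : prime_ideal PA' by apply: (@prime_ideal_preim _ _ (@poly_to_mpoly A n)).
have Qp := prime_contraction Pp.
have [a [hQ locQ]] := IH _ Qp.
have QA : [set f | contraction P (map_mpoly phi f)] = const_ideal PA'.
  apply/predeqP => x; rewrite /const_ideal /PA' /PA /contraction /=.
  by rewrite poly_to_mpolyC map_widen.
rewrite QA in locQ.
have [PAQ|nPAQ] := pselect (PA' `<=` coef_ideal (const_ideal PA')).
  exists a; split; first exact: height_contraction.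
  exact/locally_generated_mpoly/(locally_generated_poly PA'p locQ PAQ).
exists a.+1; split; last first.
  exact/locally_generated_mpoly/(locally_generated_polyS PA'p locQ nPAQ).
apply: height_contractionS => // PQ; apply: nPAQ => f Pf j.
have : P (map_mpoly phi (poly_to_mpoly f)) by [].
move=> /PQ; rewrite map_s /extension /= poly_to_mpolyK => /(_ j).
by rewrite coef_map -QA.
Qed.

(** * The height bounds the exponents *)

(** Multiplying by a power of h replaces I by an ideal with a generators, all
    of whose powers beyond a (p - 1) lie in the ideal of p-th powers of the
    generators. *)
Lemma trace_ideal_codim (T : comNzRingType) (p a M : nat) (g : 'I_a -> T)
    (I : set T) (h : T) : (0 < p)%N ->
  (forall x, I x -> ideal_gen (range g) (h * x)) -> (a * p.-1 < M)%N ->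
  trace_ideal p (ideal_pow I M) 1 -> ideal_gen (range g) (h ^+ M).
Proof.
move=> p0 hI ltM; set G := ideal_gen (range g).
have Gid : is_ideal G by apply: ideal_gen_ideal.
have [G0 GD GM] := Gid.
rewrite -[X in _ -> G X]mulr1; move: (1 : T).
apply: (@trace_pow_min _ _ _ _ [set z | G (h ^+ M * z)]).
  split=> /= [|x y|b x]; first by rewrite mulr0.
    by rewrite mulrDr; apply: GD.
  by rewrite mulrCA; apply: GM.
move=> phi b phiC Ib /=; have [_ phiM] := phiC.
rewrite -phiM -exprM -(prednK p0) mulnS exprD mulrC.
have -> : \prod_(i < M) b i * (h ^+ M * h ^+ (M * p.-1)) =
    h ^+ (M * p.-1) * \prod_(i < M) (h * b i).
  by rewrite big_split prodr_const card_ord /= mulrC -mulrA mulrCA.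
have : ideal_gen (range (fun i => g i ^+ p)) (\prod_(i < M) (h * b i)).
  apply: (ideal_pow_frobenius ltM); apply: ideal_pow_gen.
  by apply: ideal_pow_prod => i; apply: hI.
move: (\prod_(i < M) (h * b i)) => x gx.
move: x gx (h ^+ (M * p.-1)).
apply: (@ideal_gen_min _ [set x | forall b, G (phi (b * x))]).
  split=> /= [u|x y Gx Gy u|u x Gx v].
  - by rewrite mulr0 (cartier_map0 phiC).
  - by have [phiD _] := phiC; rewrite mulrDr phiD; apply: GD.
  - by rewrite mulrA.
move=> _ [i _ <-] u; rewrite mulrC phiM.
by apply: (ideal_mulr _ Gid); apply: sub_ideal_gen; exists i.
Qed.

Lemma prime_height_ge_le (T : comNzRingType) (P : set T) j k :
  (j <= k)%N -> prime_height_ge P k -> prime_height_ge P j.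
Proof.
move=> le_jk [Q [Qp Qlt Qk]]; exists (fun i => Q (i + (k - j))%N).
split=> [i lei|i lti|]; last by rewrite subnKC.
  by apply: Qp; rewrite -[X in (_ <= X)%N](subnKC le_jk) leq_add2r.
by rewrite addSn; apply: Qlt; rewrite -[X in (_ < X)%N](subnKC le_jk) ltn_add2r.
Qed.

(** Bundles a residue ring, known to be a field by its inverses only. *)
Lemma inverses_fieldType (K : comNzRingType) :
    (forall x : K, x != 0 -> exists y, x * y = 1) ->
  exists (F : fieldType) (kappa : {rmorphism K -> F}), injective kappa.
Proof.
move=> Kfield.
have ex (x : K) : exists y, x != 0 -> y * x = 1.
  have [->|x0] := eqVneq x 0; first by exists 0.
  by have [y xy] := Kfield x x0; exists y; rewrite mulrC.
have /choice[inv0 inv0P] := ex.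
pose inv (x : K) := if x == 0 then 0 else inv0 x.
have invP x : x != 0 -> inv x * x = 1.
  by rewrite /inv => x0; rewrite (negbTE x0); apply: inv0P.
have inv_0 : inv 0 = 0 by rewrite /inv eqxx.
pose B := GRing.ComNzRing_isField.Build K invP inv_0.
pose F : fieldType := HB.pack K B.
by exists F, (idfun : K -> F).
Qed.

(** An upper bound for the threshold of I mod p that is uniform in p: local
    generators of a prime of height c containing I have reductions that are
    not the unit ideal, even after inverting h, wherever a does not vanish. *)
Lemma reduction_trace_bound n r c (A : comNzRingType) (C : fieldType)
    (phi : {rmorphism A -> C}) (f : 'I_r -> {mpoly A[n]}) (P : set {mpoly C[n]}) :
    injective phi -> prime_ideal P -> (forall j, P (map_mpoly phi (f j))) ->
    ~ prime_height_ge P c.+1 ->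
  exists2 a : A, a != 0 &
  forall (K : comNzRingType) (theta : {rmorphism A -> K}) (p M : nat),
    (forall x : K, x != 0 -> exists y, x * y = 1) -> theta a != 0 -> (0 < p)%N ->
    trace_ideal p
      (ideal_pow (ideal_gen (range (fun j => map_mpoly theta (f j)))) M) 1 ->
  (M <= c * p.-1)%N.
Proof.
move=> phi_inj Pp Pf hP; have [k [hk [g [Pg gP]]]] := height_locally_generated phi_inj Pp.
have le_kc : (k <= c)%N.
  by rewrite leqNgt; apply/negP => lt; apply: hP; apply: prime_height_ge_le hk.
pose PA := [set f | P (map_mpoly phi f)].
have PAp : prime_ideal PA by apply: prime_ideal_preim.
have [PAid PA1 _] := PAp.
have /choice[H HP] : forall j, exists h, ~ PA h /\ ideal_gen (range g) (h * f j).
  by move=> j; apply: gP; apply: Pf.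
pose h := \prod_(j < r) H j.
have nPh : ~ PA h by apply: prime_ideal_prod => // j; case: (HP j).
have hf j : ideal_gen (range g) (h * f j).
  rewrite /h (bigD1 j) //= mulrAC; apply: (ideal_mulr _ (ideal_gen_ideal _)).
  by case: (HP j).
have [a [nPa ext]] := extend_specialization_mpoly PAp nPh.
exists a; first by apply: contra_notN nPa => /eqP ->; rewrite mpolyC0; case: PAid.
move=> K theta p M Kfield tha p0 IM; rewrite leqNgt; apply/negP => ltM.
have [F [kappa kappa_inj]] := inverses_fieldType Kfield.
pose thF : {rmorphism A -> F} := kappa \o theta.
have thP x : PA (mpolyC n x) -> thF x = 0.
  rewrite /PA /= map_mpolyC => Px.
  have [->|x0] := eqVneq x 0; first by rewrite !rmorph0.
  have [[_ _ PM] P1 _] := Pp; case: P1.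
  have -> : 1 = mpolyC n (phi x)^-1 * mpolyC n (phi x).
    by rewrite -mpolyCM mulVf ?mpolyC1 // -(rmorph0 phi) (inj_eq phi_inj).
  exact: PM.
have thFa : thF a != 0 by rewrite /= -(rmorph0 kappa) (inj_eq kappa_inj).
have [L [iota [th [thC thPA thh]]]] := ext F thF thP thFa.
pose iK : {rmorphism K -> L} := iota \o kappa.
pose ev : {rmorphism {mpoly K[n]} -> L} := mmap iK (fun i => th 'X_i).
have evE x : ev (map_mpoly theta x) = th x.
  move: x; apply: (@mpoly_morph_ext A L n (ev \o map_mpoly theta) th) => [x|i] /=.
    by rewrite map_mpolyC /= mmapC thC.
  by rewrite map_mpolyX mmapX mmap1U.
pose gK i := map_mpoly theta (g i).
have red x : ideal_gen (range g) x -> ideal_gen (range gK) (map_mpoly theta x).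
  move: x; apply: (@ideal_gen_min _ [set x | ideal_gen (range gK) (map_mpoly theta x)]).
    by apply: ideal_preim; apply: ideal_gen_ideal.
  by move=> _ [i _ <-]; apply: sub_ideal_gen; exists i.
have := @trace_ideal_codim _ p k M gK _ (map_mpoly theta h) p0 _ _ IM.
have hI x : ideal_gen (range (fun j => map_mpoly theta (f j))) x ->
    ideal_gen (range gK) (map_mpoly theta h * x).
  move: x; apply: (@ideal_gen_min _ [set x | ideal_gen (range gK) (_ * x)]).
    have [J0 JD JM] := ideal_gen_ideal (range gK).
    split=> /= [|x y|b x]; first by rewrite mulr0.
      by rewrite mulrDr; apply: JD.
    by rewrite mulrCA; apply: JM.
  by move=> _ [j _ <-] /=; rewrite -rmorphM; exact: red (hf j).
move=> /(_ hI (leq_ltn_trans (leq_mul le_kc (leqnn _)) ltM)).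
have : ideal_gen (range gK) `<=` [set x | ev x = 0].
  apply: ideal_gen_min.
    split=> [|x y ex ey|b x ex]; first exact: (rmorph0 ev).
      by apply: (etrans (rmorphD ev x y)); rewrite [ev x]ex [ev y]ey addr0.
    by apply: (etrans (rmorphM ev b x)); rewrite [ev x]ex mulr0.
  by move=> _ [i _ <-] /=; rewrite evE; exact: thPA (Pg i).
move=> /[apply] /= /eqP; rewrite rmorphXn expf_eq0 /= evE.
by rewrite (negbTE thh) andbF.
Qed.

(** * Descent of ideal membership *)

Lemma ideal_gen_rangeP (T : comNzRingType) s (h : 'I_s -> T) x :
  ideal_gen (range h) x -> exists q : 'I_s -> T, x = \sum_(i < s) q i * h i.
Proof.
move: x; apply: (@ideal_gen_min _ [set x | exists q : 'I_s -> T, x = _]); last first.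
  move=> _ [i _ <-]; exists (fun j => (j == i)%:R).
  by rewrite (bigD1 i) //= eqxx mul1r big1 ?addr0 // => j /negbTE ->; rewrite mul0r.
split=> /= [|_ _ [q ->] [q' ->]|a _ [q ->]].
- by exists (fun=> 0); rewrite big1 // => i _; rewrite mul0r.
- exists (fun i => q i + q' i); rewrite -big_split.
  by apply: eq_bigr => i _; rewrite mulrDl.
- by exists (fun i => a * q i); rewrite mulr_sumr; apply: eq_bigr => i _; rewrite mulrA.
Qed.

(** A linear retraction of C onto the fraction field of A, applied to the
    coefficients of the cofactors, turns a relation over C into a relation
    over that fraction field; it remains to clear denominators. *)
Lemma ideal_gen_descent n s (A : comNzRingType) (C : fieldType)
    (phi : {rmorphism A -> C}) (h : 'I_s -> {mpoly A[n]}) (g : {mpoly A[n]}) :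
    injective phi ->
    ideal_gen (range (fun i => map_mpoly phi (h i))) (map_mpoly phi g) ->
  exists2 a : A, a != 0 & ideal_gen (range h) (mpolyC n a * g).
Proof.
move=> phi_inj /ideal_gen_rangeP[q gE].
have phi0 (a : A) : (phi a == 0) = (a == 0) by rewrite -(rmorph0 phi) (inj_eq phi_inj).
have A_dom (a b : A) : a != 0 -> b != 0 -> a * b != 0.
  by rewrite -!phi0 rmorphM mulf_eq0 negb_or => -> ->.
pose F := [set x | exists a b, b != 0 /\ phi b * x = phi a].
have Fphi a : F (phi a) by exists a, 1; rewrite oner_eq0 rmorph1 mul1r.
have [||||rho [Frho rhoD rhoM rho1]] := @subfield_retraction C F.
- by rewrite -(rmorph1 phi).
- move=> x y [a [b [b0 bx]]] [a' [b' [b'0 by']]].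
  exists (b' * a - b * a'), (b * b'); split; first exact: A_dom.
  by rewrite rmorphB !rmorphM mulrBr -bx -by' -[phi b * _ * x]mulrA mulrCA !mulrA.
- move=> x y [a [b [b0 bx]]] [a' [b' [b'0 by']]].
  exists (a * a'), (b * b'); split; first exact: A_dom.
  by rewrite !rmorphM mulrACA bx by'.
- move=> x [a [b [b0 bx]]] x0; exists x^-1; last by rewrite divff.
  have a0 : a != 0 by rewrite -phi0 -bx mulf_neq0 ?phi0.
  by exists b, a; split=> //; rewrite -bx mulfK.
have rhoB : {morph rho : x y / x - y}.
  by move=> x y; apply/eqP; rewrite eq_sym subr_eq -rhoD subrK.
pose rhoA : {additive C -> C} :=
  HB.pack rho (GRing.isZmodMorphism.Build _ _ rho rhoB).
have gE' : map_mpoly phi g = \sum_(i < s) map_mpoly rhoA (q i) * map_mpoly phi (h i).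
  apply/mpolyP => m; rewrite mcoeff_map_mpoly -[LHS]mulr1 -rho1 -rhoM; last first.
    exact: Fphi.
  rewrite mulr1 -(mcoeff_map_mpoly phi) gE -[rho _]/(rhoA _) !raddf_sum.
  apply: eq_bigr => i _.
  rewrite /= !mcoeffM -[rho _]/(rhoA _) raddf_sum; apply: eq_bigr => k _ /=.
  rewrite -[map_mpoly rho _]/(map_mpoly rhoA _) !mcoeff_map_mpoly /=.
  have rhoMr x a : rho (x * phi a) = rho x * phi a.
    by rewrite mulrC rhoM // mulrC.
  exact: rhoMr.
pose E := [set z | exists b w,
  [/\ b != 0, ideal_gen (range h) w & map_mpoly phi w = mpolyC n (phi b) * z]].
have Jid := ideal_gen_ideal (range h); have [J0 JD JM] := Jid.
have ED x y : E x -> E y -> E (x + y).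
  move=> [b [w [b0 Jw ew]]] [b' [w' [b'0 Jw' ew']]].
  exists (b * b'), (mpolyC n b' * w + mpolyC n b * w'); split.
  - exact: A_dom.
  - by apply: JD; apply: JM.
  rewrite rmorphD !rmorphM /= !map_mpolyC ew ew' mulrDr.
  by rewrite !mulrA [mpolyC n (phi b') * _]mulrC.
have E0 : E 0.
  by exists 1, 0; split; rewrite ?oner_eq0 // rmorph0 mulr0.
have Eh x k i : F x -> E (x *: mpolyX _ k * map_mpoly phi (h i)).
  move=> [a [b [b0 bx]]]; exists b, (mpolyC n a * mpolyX _ k * h i); split=> //.
    by apply: JM; apply: sub_ideal_gen; exists i.
  have -> : map_mpoly phi (mpolyC n a * mpolyX _ k * h i) =
      mpolyC n (phi a) * mpolyX _ k * map_mpoly phi (h i).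
    by rewrite !rmorphM /= map_mpolyC map_mpolyX.
  by rewrite -bx -mul_mpolyC !mulrA -mpolyCM.
have : E (map_mpoly phi g).
  rewrite gE'; elim/big_ind: _ => // i _.
  rewrite [map_mpoly rhoA _]mpolyE mulr_suml.
  elim/big_ind: _ => // m _; apply: Eh.
  by rewrite mcoeff_map_mpoly; apply: Frho.
move=> [b [w [b0 Jw ew]]]; exists b => //.
suff -> : mpolyC n b * g = w by [].
apply/mpolyP => m; apply: phi_inj; rewrite -!mcoeff_map_mpoly ew rmorphM /=.
by rewrite map_mpolyC.
Qed.

(** * Reduction modulo a maximal ideal *)

Lemma maximal_quot_inverse (R : comNzRingType) (m : idealr R) :
  maximal_ideal [set x | x \in m] ->
  forall x : {ideal_quot m}, x != 0 -> exists y, x * y = 1.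
Proof.
move=> [mid _ mmax] x x0; pose r := repr x; have xr : x = \pi r by rewrite reprK.
have nr : r \notin m.
  apply: contra x0 => rm; rewrite xr -(rmorph0 \pi_({ideal_quot m})).
  by rewrite -[_ == _]Quotient.idealrBE subr0.
pose J := [set z | exists u b, u \in m /\ z = u + b * r].
have Jid : is_ideal J.
  split=> [|_ _ [u [b [um ->]]] [v [d [vm ->]]]|w _ [u [b [um ->]]]].
  - by exists 0, 0; rewrite idealr0 mul0r addr0.
  - by exists (u + v), (b + d); rewrite rpredD // mulrDl addrACA.
  - by exists (w * u), (w * b); rewrite idealMr // mulrDr mulrA.
have mJ : [set x | x \in m] `<=` J.
  by move=> u um; exists u, 0; rewrite mul0r addr0.
have [u [b [um e1]]] : J 1.
  apply: contrapT => J1; have := mmax J Jid mJ J1.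
  move/predeqP/(_ r) => [+ _]; rewrite /= (negbTE nr).
  suff Jr : J r by move/(_ Jr).
  by exists 0, 1; rewrite idealr0 add0r mul1r.
exists (\pi b); rewrite xr -rmorphM -(rmorph1 \pi_({ideal_quot m})).
apply/eqP; rewrite -[_ == _]Quotient.idealrBE e1 mulrC opprD addrCA subrr addr0.
by rewrite rpredN.
Qed.

Lemma map_mpoly_comp (R S T : comNzRingType) n (phi : {rmorphism R -> S})
    (psi : {rmorphism S -> T}) (f : {mpoly R[n]}) :
  map_mpoly psi (map_mpoly phi f) = map_mpoly (psi \o phi) f.
Proof. by apply/mpolyP => l; rewrite !mcoeff_map_mpoly. Qed.

Lemma map_mpoly_inj (R S : comNzRingType) n (phi : {rmorphism R -> S}) :
  injective phi -> injective (map_mpoly phi : {mpoly R[n]} -> {mpoly S[n]}).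
Proof.
move=> phi_inj f g /mpolyP e; apply/mpolyP => l; apply: phi_inj.
by have := e l; rewrite !mcoeff_map_mpoly.
Qed.

Section SubringReduction.
Variables (U : comNzRingType) (A : subringClosed U).

Lemma mpolyOver_lift N (f : {mpoly U[N]}) : f \is a mpolyOver N A ->
  exists f' : {mpoly (subring_of A)[N]},
    map_mpoly (val : subring_of A -> U) f' = f.
Proof.
move=> /mpolyOverP Af.
exists (\sum_(m <- msupp f) (insubd (0 : subring_of A) (mcoeff m f)) *: mpolyX _ m).
apply/mpolyP => k; rewrite mcoeff_map_mpoly [in RHS](mpolyE f) !raddf_sum.
apply: eq_bigr => m _; rewrite /= !mcoeffZ !mcoeffX.
case: (m == k); rewrite ?mulr1 ?mulr0; last exact: (rmorph0 (val : subring_of A -> U)).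
by apply: (insubdK (0 : subring_of A)); apply: Af.
Qed.

Variable a : subring_of A.

Lemma sub_localization x : x \in A -> x \in localization a.
Proof. by move=> Ax; apply/asboolP; exists 0%N; rewrite expr0 mul1r. Qed.

Definition to_localization (x : subring_of A) : subring_of (localization a) :=
  Sub (val x) (sub_localization (valP x)).

Lemma to_localization_zmod : zmod_morphism to_localization.
Proof. by move=> x y; apply: val_inj. Qed.

Lemma to_localization_monoid : monoid_morphism to_localization.
Proof.
by split=> [|x y]; apply: val_inj.
Qed.

HB.instance Definition _ := GRing.isZmodMorphism.Build
  (subring_of A) (subring_of (localization a)) to_localization to_localization_zmod.
HB.instance Definition _ := GRing.isMonoidMorphism.Build
  (subring_of A) (subring_of (localization a)) to_localization to_localization_monoid.

Variable m : idealr (subring_of (localization a)).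

Definition reduce : subring_of A -> {ideal_quot m} :=
  \pi_({ideal_quot m}) \o to_localization.
HB.instance Definition _ := GRing.RMorphism.copy reduce
  (\pi_({ideal_quot m}) \o to_localization).

Lemma ideal_red_gen N k (h : 'I_k -> {mpoly (subring_of A)[N]}) :
  ideal_red m (fun i => map_mpoly (val : subring_of A -> U) (h i)) =
  ideal_gen (range (fun i => map_mpoly reduce (h i))).
Proof.
pose valA : {rmorphism subring_of A -> U} := (val : subring_of A -> U).
pose valL : {rmorphism subring_of (localization a) -> U} :=
  (val : subring_of (localization a) -> U).
pose pim : {rmorphism subring_of (localization a) -> {ideal_quot m}} :=
  \pi_({ideal_quot m}).
pose loc : {rmorphism subring_of A -> subring_of (localization a)} :=
  to_localization.
have val_loc i : map_mpoly valL (map_mpoly loc (h i)) = map_mpoly valA (h i).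
  by rewrite map_mpoly_comp; congr (map_mpoly _ _); apply/funext.
have red_loc i : map_mpoly pim (map_mpoly loc (h i)) = map_mpoly reduce (h i).
  exact: map_mpoly_comp.
have valL_inj : injective (map_mpoly valL : {mpoly _[N]} -> _).
  exact/map_mpoly_inj/val_inj.
apply/seteqP; split; apply: ideal_gen_min; try exact: ideal_gen_ideal.
  move=> _ [q hq <-]; move: q hq.
  apply: (@ideal_gen_min _ [set q | ideal_gen
    (range (fun i => map_mpoly reduce (h i))) (map_mpoly pim q)]).
    exact: (ideal_preim (map_mpoly pim) (ideal_gen_ideal _)).
  move=> q [i hi]; apply: sub_ideal_gen; exists i; first exact: I.
  have -> : q = map_mpoly loc (h i) by apply: valL_inj; rewrite val_loc; exact: hi.
  exact/esym/red_loc.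
move=> _ [i _ <-]; rewrite -red_loc; apply: sub_ideal_gen.
apply: imageP; apply: sub_ideal_gen; exists i; exact: val_loc.
Qed.

End SubringReduction.

Lemma reduce_neq0 (U : fieldType) (A : subringClosed U) (a : subring_of A)
    (m : idealr (subring_of (localization a))) : val a != 0 -> reduce m a != 0.
Proof.
move=> a0.
have Vin : (val a)^-1 \in localization a.
  by apply/asboolP; exists 1%N; rewrite expr1 divff ?rpred1.
pose b : subring_of (localization a) := Sub (val a)^-1 Vin.
have ab : to_localization a a * b = 1.
  by apply: val_inj; rewrite -[LHS]/(val a * (val a)^-1) divff.
pose pim : {rmorphism subring_of (localization a) -> {ideal_quot m}} :=
  \pi_({ideal_quot m}).
apply/eqP => r0; have := rmorphM pim (to_localization a a) b.
rewrite ab rmorph1 [pim _]r0 mul0r => /eqP.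
by rewrite oner_eq0.
Qed.

Lemma map_generic_g (A B : comNzRingType) (phi : {rmorphism A -> B}) n c r
    (f : 'I_r -> {mpoly A[n]}) i :
  map_mpoly phi (generic_g c f i) = generic_g c (fun j => map_mpoly phi (f j)) i.
Proof.
rewrite rmorph_sum; apply: eq_bigr => j _; rewrite rmorphM /= map_mpolyX.
congr (_ * _); move: (f j).
apply: (@mpoly_morph_ext A _ n (map_mpoly phi \o @to_generic A n c r)
   (@to_generic B n c r \o map_mpoly phi)) => [x|k] /=.
  by rewrite to_genericC !map_mpolyC to_genericC.
by rewrite to_genericX !map_mpolyX to_genericX.
Qed.

(** * Comparison of thresholds in characteristic p *)

Section Thresholds.
Variables (RR : realType) (K : comNzRingType) (p n c r : nat).
Hypothesis chK : p \in [pchar K].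
Hypothesis Kfield : forall x : K, x != 0 -> exists y, x * y = 1.
Hypothesis n_gt0 : (0 < n)%N.
Variable f : 'I_r -> {mpoly K[n]}.
Local Notation I := (ideal_gen (range f)).
Local Notation L := (ideal_gen (range (generic_g c f))).
Local Notation fptR := (fpt RR (pchar_mpoly n chK)).
Local Notation fptS := (fpt RR (pchar_mpoly (n + c * r) chK)).

Lemma fpt_generic_le : (fptS L <= fptR I)%E.
Proof.
apply: ge_ereal_sup => _ [t [t0 Lt] <-]; apply: fpt_ge_limit => //.
have [e0 He0] := F_pure_pair_trace Lt.
by exists e0 => e /He0; apply: trace_linkage_sub.
Qed.

Hypothesis c_gt0 : (0 < c)%N.
Hypothesis trace_bound : forall M,
  trace_ideal p (ideal_pow I M) 1 -> (M <= c * p.-1)%N.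

(** In t p <= M + r + 2 the term r + 1 comes from the rounding to level 1, and
    the remaining 1 from the floor in N, since t (p Q - 1) < N + 1 and
    t + 1 <= Q. *)
Lemma fpt_le_generic : (fptR I <= fptS L + ((r + 2)%:R / p%:R)%:E)%E.
Proof.
have p_pr := pcharf_prime chK; have p_gt1 := prime_gt1 p_pr.
have p_gt0 : (0 < p)%N by rewrite ltnW.
have nS_gt0 : (0 < n + c * r)%N by rewrite addn_gt0 n_gt0.
have p0 : (0 : RR) < p%:R by rewrite ltr0n.
apply: ge_ereal_sup => _ [t [t0 It] <-].
have [e0 He0] := F_pure_pair_trace It.
have [e1 He1] := exists_expn_ge chK (t + 1).
have [e2 He2] := exists_expn_ge chK (t^-1 + 1).
pose e := (e0 + e1 + e2)%N; pose N := Num.truncn (t * (p ^ e.+1 - 1)%N%:R).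
pose Q := (p ^ e)%N.
have pe_gt0 : (0 < p ^ e.+1)%N by rewrite expn_gt0 p_gt0.
have Q_gt0 : (0 < Q)%N by rewrite expn_gt0 p_gt0.
have IN : trace_ideal (p ^ e.+1) (ideal_pow I N) 1.
  by apply: He0; rewrite /e -!addnA -addnS leq_addr.
have N_gt0 : (0 < N)%N.
  rewrite truncn_gt0 natrB //.
  have le2 : (e2 <= e.+1)%N by apply: leqW; apply: leq_addl.
  have := He2 _ le2; by rewrite -lerBrDr -(ler_pM2l t0) divff ?gt_eqF.
(* This excludes the value -oo, the supremum of the empty set. *)
have L_ge0 : (0 <= fptS L)%E.
  have I1 : trace_ideal (p ^ e.+1) (ideal_pow I 1) 1.
    move: IN; apply: trace_ideal_min; first exact: trace_ideal_ideal.
    move=> phi b phiC Ib; apply: trace_ideal_cartier => //.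
    exact: ideal_pow_le Ib.
  have le1 : (1 <= c * p.-1)%N by rewrite muln_gt0 c_gt0 -ltnS prednK.
  have L1 := trace_linkage_sup chK (ltn0Sn e) le1 I1.
  apply: le_trans (fpt_ge_trace RR chK Kfield nS_gt0 (ltn0Sn 0) L1).
  by rewrite lee_fin divr_ge0.
pose M := (N %/ Q - r)%N.
have IM : trace_ideal p (ideal_pow I M) 1.
  exact: trace_ideal_level (pchar_mpoly n chK) IN.
have leM := trace_bound IM.
have L_ge : ((M%:R / p%:R)%:E <= fptS L)%E.
  have [->|M0] := posnP M; first by rewrite mul0r.
  have IM1 : trace_ideal (p ^ 1) (ideal_pow I M) 1 by rewrite expn1.
  have LM := trace_linkage_sup chK (ltn0Sn 0) leM IM1.
  by have := fpt_ge_trace RR chK Kfield nS_gt0 M0 LM; rewrite expn1.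
apply: le_trans (leeD2r _ L_ge); rewrite -EFinD lee_fin -mulrDl.
rewrite ler_pdivlMr //.
have Q0 : (0 : RR) < Q%:R by rewrite ltr0n.
have Nlt : t * ((p ^ e.+1)%:R - 1) < N%:R + 1.
  by have := truncnS_gt (t * (p ^ e.+1 - 1)%N%:R); rewrite -/N -natr1 natrB.
have leQ : t + 1 <= Q%:R by apply: He1; rewrite /e addnAC leq_addl.
have NQ : (N%:R : RR) <= (M + r + 1)%:R * Q%:R.
  rewrite -natrM ler_nat addn1; apply/ltnW; rewrite -ltn_divLR // ltnS addnC.
  by rewrite -leq_subLR.
rewrite -(ler_pM2r Q0).
have -> : t * p%:R * Q%:R = t * (p ^ e.+1)%:R by rewrite expnS natrM mulrA.
move: Nlt; rewrite mulrBr mulr1 ltrBlDr => /ltW /le_trans; apply.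
have -> : M%:R + (r + 2)%:R = (M + r + 1)%:R + 1 :> RR.
  by rewrite -natrD natr1 addn1 addn2 !addnS.
by rewrite mulrDl mul1r -addrA lerD // addrC.
Qed.

End Thresholds.

Lemma rmorph_prod_neq0 (A B : comNzRingType) (theta : {rmorphism A -> B}) k x
    (y : 'I_k -> A) : theta (x * \prod_(i < k) y i) != 0 ->
  theta x != 0 /\ forall i, theta (y i) != 0.
Proof.
move=> xy0; split=> [|i]; apply: contraNneq xy0 => e.
  by rewrite rmorphM e mul0r.
by rewrite rmorphM rmorph_prod (bigD1 i) //= e mul0r mulr0.
Qed.

Theorem theorem1p4 (RR : realType) (n c r s : nat)
    (f : 'I_r -> {mpoly RR[i][n]})
    (hI0 : exists2 x, ideal_gen (range f) x & x != 0)
    (hIeq : equidimensional (ideal_gen (range f)))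
    (hIc : ideal_height (ideal_gen (range f)) c)
    (h : 'I_s -> {mpoly RR[i][n + c * r]})
    (hJ : ideal_gen (range h) = generic_linkage c f)
    (A : subringClosed RR[i])
    (hAfg : finitely_generated_Zalg A)
    (hAf : forall j, f j \is a mpolyOver n A)
    (hAh : forall i, h i \is a mpolyOver (n + c * r) A) :
  exists2 a : subring_of A, val a != 0 &
  exists2 P : nat, prime P &
  exists C1 : RR,
  forall p : nat, prime p -> (P < p)%N ->
  forall m : idealr (subring_of (localization a)),
  maximal_ideal [set x | x \in m] ->
  forall chK : p \in [pchar {ideal_quot m}],
  let fptR := fpt RR (pchar_mpoly n chK) in
  let fptS := fpt RR (pchar_mpoly (n + c * r) chK) in
  let Ip := ideal_red m f in
  let Lp := ideal_red m (generic_g c f) in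
  let Jp := ideal_red m h in
  [/\ (fptS Lp <= fptR Ip)%E,
      (fptR Ip <= fptS Lp + (C1 / p%:R)%:E)%E &
      (fptS Lp + (C1 / p%:R)%:E <= fptS Jp + (C1 / p%:R)%:E)%E].
Proof.
have [I1 _] := hIeq; have [[P [Pp IP [_ hP]]] _] := hIc.
have [x Ix x0] := hI0.
(* Without variables the nonzero ideal I would contain 1. *)
have n_gt0 : (0 < n)%N.
  rewrite lt0n; apply/eqP => n0; apply: I1; move: x Ix x0.
  move=> {hI0 hIeq hIc hJ hAf hAh h IP P Pp hP} x Ix x0; move: x Ix x0.
  rewrite {}n0 in f * => x Ix x0.
  have xE : x = mpolyC 0 (mcoeff mnm0 x).
    apply/mpolyP => k; have -> : k = mnm0 by apply/mnmP => -[].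
    by rewrite mcoeffC eqxx mulr1.
  have [_ _ IM] := ideal_gen_ideal (range f).
  have c0 : mcoeff mnm0 x != 0 by apply: contraNneq x0 => c0; rewrite xE c0 mpolyC0.
  have -> : 1 = mpolyC 0 (mcoeff mnm0 x)^-1 * x.
    by rewrite {2}xE -mpolyCM mulVf ?mpolyC1.
  exact: IM.
(* The zero ideal lies strictly below P. *)
have c_gt0 : (0 < c)%N.
  rewrite lt0n; apply/eqP => c0; apply: hP; rewrite c0.
  exists (fun i => if i is 0%N then [set 0] else P); split=> // [[|i] _ //|[|i] // _].
    split=> [|/eqP|y z /eqP].
    - by split=> [//|y z -> ->|y z ->]; rewrite ?addr0 ?mulr0.
    - by rewrite oner_eq0.
    - by rewrite mulf_eq0 => /orP[] /eqP; [left | right].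
  split=> [_ ->|le]; first by case: Pp => [[]].
  by move/eqP: x0; apply; apply: le; apply: IP.
pose phi : {rmorphism subring_of A -> RR[i]} := (val : subring_of A -> RR[i]).
have phi_inj : injective phi := val_inj.
have /choice[f' f'E] := fun j => mpolyOver_lift (hAf j).
have /choice[h' h'E] := fun i => mpolyOver_lift (hAh i).
have fE : f = fun j => map_mpoly phi (f' j) by apply/funext => j; rewrite -f'E.
have hE : h = fun i => map_mpoly phi (h' i) by apply/funext => i; rewrite -h'E.
have gE : generic_g c f = fun i => map_mpoly phi (generic_g c f' i).
  by apply/funext => i; rewrite map_generic_g fE.
have Pf j : P (map_mpoly phi (f' j)).
  by apply: IP; apply: sub_ideal_gen; exists j => //; rewrite fE.
have [a1 a1_0 bound] := reduction_trace_bound phi_inj Pp Pf hP.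
have gJ i : ideal_gen (range (fun i => map_mpoly phi (h' i)))
                      (map_mpoly phi (generic_g c f' i)).
  rewrite -hE hJ => y _.
  apply: (ideal_mulr _ (ideal_gen_ideal _)); apply: sub_ideal_gen.
  by exists i => //; rewrite gE.
have /choice[a2 a2P] : forall i, exists a2 : subring_of A,
    a2 != 0 /\ ideal_gen (range h') (mpolyC _ a2 * generic_g c f' i).
  by move=> i; have [a2 a20 ga2] := ideal_gen_descent phi_inj (gJ i); exists a2.
have phi0 (x1 : subring_of A) : (phi x1 == 0) = (x1 == 0).
  by rewrite -(rmorph0 phi) (inj_eq phi_inj).
exists (a1 * \prod_(i < c) a2 i).
  rewrite -[val _]/(phi _) rmorphM rmorph_prod mulf_neq0 ?phi0 //.
  by apply/prodf_neq0 => i _; rewrite phi0; case: (a2P i).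
exists 2%N => //; exists (r + 2)%:R => p p_pr _ m mmax chK /=.
have Kfield := maximal_quot_inverse mmax.
pose theta : {rmorphism subring_of A -> {ideal_quot m}} := reduce m.
have th_neq0 : theta (a1 * \prod_(i < c) a2 i) != 0.
  apply: reduce_neq0; rewrite -[val _]/(phi _) rmorphM rmorph_prod mulf_neq0 ?phi0 //.
  by apply/prodf_neq0 => i _; rewrite phi0; case: (a2P i).
have [tha1 tha2] := rmorph_prod_neq0 th_neq0.
pose fK j := map_mpoly theta (f' j).
have IE : ideal_red m f = ideal_gen (range fK) by rewrite fE ideal_red_gen.
have LE : ideal_red m (generic_g c f) = ideal_gen (range (generic_g c fK)).
  have -> : generic_g c fK = fun i => map_mpoly theta (generic_g c f' i).
    by apply/funext => i; rewrite map_generic_g.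
  by rewrite gE ideal_red_gen.
have JE : ideal_red m h = ideal_gen (range (fun i => map_mpoly theta (h' i))).
  by rewrite hE ideal_red_gen.
rewrite IE LE JE; split.
- exact: fpt_generic_le.
- apply: fpt_le_generic; [exact: Kfield | exact: n_gt0 | exact: c_gt0 | move=> M IM].
  exact: (bound _ _ _ _ Kfield tha1 (prime_gt0 p_pr) IM).
apply: leeD2r; apply: fpt_mono; apply: (ideal_gen_min (ideal_gen_ideal _)).
move=> _ [i _ <-]; set J := ideal_gen _.
have Jid : is_ideal J by apply: ideal_gen_ideal.
have red y : ideal_gen (range h') y -> J (map_mpoly theta y).
  move: y; apply: (@ideal_gen_min _ [set y | J (map_mpoly theta y)]).
    exact: (ideal_preim (map_mpoly theta)).
  by move=> _ [k _ <-]; apply: sub_ideal_gen; exists k.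
have [_ /red] := a2P i.
rewrite rmorphM /= map_mpolyC map_generic_g.
have [b ab] := Kfield _ (tha2 i).
have [_ _ JM] := Jid; move=> /(JM (mpolyC _ b)).
by rewrite mulrA -mpolyCM [b * _]mulrC ab mpolyC1 mul1r.
Qed.
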